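(* In the setting described in the context, consider the following two procedures. (Algorithm 1) Given an infeasible value $\alpha_{\max}\in\mathbb{N}_0$: set $\alpha_1=\alpha_{\max}$, let $X_1$ be a minimizer of $\tilde{v}^{\alpha_1}$ over $2^{\hat{R}\setminus\hat{Q}}$, and $i=1$. While $\tilde{v}^{\alpha_i}(X_i)<0$: let $\alpha_{i+1}$ be the maximum $\alpha\ge0$ with $\tilde{v}^\alpha(X_i)\ge0$; let $X_{i+1}$ be a minimizer of $\tilde{v}^{\alpha_{i+1}}$ among sets $X\subsetneq X_i$; increase $i$ by one. Return $\alpha_i$. (Algorithm 2) Set $\delta_1=0$, let $X_1$ be a minimizer of $\tilde{v}^{\delta_1}$ over $2^{\hat{R}\setminus\hat{Q}}$, and $i=1$. While $\tilde{v}^{\delta_i}(X_i)<0$: let $\delta_{i+1}$ be the minimum $\delta\ge0$ with $\tilde{v}^\delta(X_i)\ge0$; let $X_{i+1}$ be a minimizer of $\tilde{v}^{\delta_{i+1}}$ among sets $X\subsetneq X_i$; increase $i$ by one. Return $\delta_i$. Then Algorithm 1 returns the maximum feasible $\alpha^*\in\mathbb{N}_0$ (i.e. the maximum $\alpha$ for which $(\mathcal{N}^\alpha,b^\alpha,T)$ is feasible), Algorithm 2 returns the minimum feasible $\delta^*\in\mathbb{N}_0$ (i.e. the minimum $\delta$ for which $(\mathcal{N}^\delta,b^\delta,T)$ is feasible), and both terminate after at most $|S|$ iterations of the while loop.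
   Context: A dynamic network $\mathcal{N} = (G,u,\tau)$ consists of a directed graph $G=(V,A)$ with capacities $u_a \in \mathbb{N}$ and transit times $\tau_a \in \mathbb{N}_0$. A flow over time with time horizon $T \in \mathbb{N}$ gives each arc $a$ an inflow rate $f_a\colon [0,T) \to [0,u_a]$; flow entering $a$ at time $\theta$ arrives at its head at time $\theta+\tau_a$; flow entering a non-terminal node must immediately leave it; all flow arrives by time $T$. A balance function $b\colon V \to \mathbb{Z}$ has $\sum_v b(v)=0$; sources $S^+=\{b>0\}$, sinks $S^-=\{b<0\}$, terminals $S=S^+\cup S^-$. $(\mathcal{N},b,T)$ is feasible if a flow over time with horizon $T$ sends exactly $b(v)$ out of each source and $-b(v)$ into each sink. For $X\subseteq S$, $o(X)$ is the value of a maximum flow over time with horizon $T$ from $S^+\cap X$ to $S^-\setminus X$; $b(X)=\sum_{v\in X}b(v)$; $v(X)=o(X)-b(X)$. An instance is feasible iff $v(X)\ge 0$ for all $X\subseteq S$. $X$ is tight if $o(X)=b(X)$. Setting: $(\mathcal{N},b,T)$ is feasible; $Q \subset R \subseteq S$ are tight sets; $\check{s}\in R\setminus Q$ is a source whose only incident arc is an arc $(\check{s},s)$ of infinite capacity and transit time $0$ to a node $s$; and $o(Q\cup\{\check{s}\}) > b(Q\cup\{\check{s}\})$. For $\alpha\in\mathbb{N}_0$, $\mathcal{N}^\alpha$ adds to $\mathcal{N}$ a new node $\hat{s}$ and an arc $(\hat{s},s)$ of capacity $\alpha$, transit time $0$; $o^\alpha(X)$, $X\subseteq S\cup\{\hat{s}\}$,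 is the maximum out-flow in $\mathcal{N}^\alpha$ ($\hat{s}$ treated as a source); $\Delta^\alpha = o^\alpha(Q\cup\{\hat{s}\})-o^\alpha(Q)$; $b^\alpha(t)=b(t)$ for $t\in S\setminus\{\check{s}\}$, $b^\alpha(\hat{s})=\Delta^\alpha$, $b^\alpha(\check{s})=b(\check{s})-\Delta^\alpha$; $v^\alpha=o^\alpha-b^\alpha$; $\alpha$ is feasible if $(\mathcal{N}^\alpha,b^\alpha,T)$ is feasible. For $\delta\in\mathbb{N}_0$, $\mathcal{N}^\delta$, $o^\delta$, $\Delta^\delta$, $b^\delta$, $v^\delta$ are defined identically except that the arc $(\hat{s},s)$ has capacity $1$ and transit time $\delta$; $\delta$ is feasible if $(\mathcal{N}^\delta,b^\delta,T)$ is feasible. Let $\hat{Q}=Q\cup\{\hat{s}\}$, $\hat{R}=R\cup\{\hat{s}\}$, and $\tilde{v}^\alpha(X)=v^\alpha(\hat{Q}\cup X)$, $\tilde{v}^\delta(X)=v^\delta(\hat{Q}\cup X)$ for $X\subseteq\hat{R}\setminus\hat{Q}$. *)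

(* Defs.v *)
From HB Require Import structures.
From mathcomp Require Import all_boot all_order all_algebra.
From mathcomp Require Import all_classical all_reals all_analysis.

Set Implicit Arguments.
Unset Strict Implicit.
Unset Printing Implicit Defensive.

Import Order.TTheory GRing.Theory Num.Theory.

Local Open Scope ring_scope.

(* A capacity is [Some c] (finite, [c] a natural number) or [None] (infinite).
   Arcs are an abstract type, so parallel arcs are allowed. *)
Record network := Network {
  vertex : finType;
  darc : finType;
  arc_tail : darc -> vertex;
  arc_head : darc -> vertex;
  capacity : darc -> option nat;
  transit : darc -> nat
}.

Section FlowsOverTime.
Variables (R : realType) (N : network) (T : nat).
Implicit Types (f : darc N -> R -> R) (P M X : {set vertex N}) (v : vertex N).

Definition within_capacity (x : R) (u : option nat) : Prop :=
  if u is Some c then x <= c%:R else True.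

(* [f a t] is the rate at which flow enters [a] at time [t]; it is extended by
   0 outside of [0, T), so that no side condition is needed in [head_rate]. *)
Definition tail_rate f v (t : R) : R := \sum_(a | arc_tail a == v) f a t.

Definition head_rate f v (t : R) : R :=
  \sum_(a | arc_head a == v) f a (t - (transit a)%:R).

Definition net_rate f v (t : R) : R := tail_rate f v t - head_rate f v t.

Definition net_outflow f v : R :=
  \int[lebesgue_measure]_(t in `[0, T%:R[%classic) net_rate f v t.

(* Flow over time with horizon [T] from the nodes in [P] to the nodes in [M].
   Nothing is stored at a node: at any time a node of [P] may only inject
   additional flow, a node of [M] may only absorb flow, and all other nodes
   forward what they receive.  The vanishing condition says both that [f a]
   lives on [0, T) and that all flow has left the arcs by time [T]. *)
Record flow_over_time P M f : Prop := FlowOverTime {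
  flow_integrable : forall a,
    lebesgue_measure.-integrable `[0, T%:R[%classic (EFin \o f a);
  flow_ge0 : forall a t, 0 <= f a t;
  flow_capacity : forall a t, within_capacity (f a t) (capacity a);
  flow_horizon : forall a t,
    t < 0 \/ T%:R <= t + (transit a)%:R -> f a t = 0;
  flow_source : forall v t, v \in P -> 0 <= net_rate f v t;
  flow_sink : forall v t, v \in M -> net_rate f v t <= 0;
  flow_conservation : forall v t, v \notin P :|: M -> net_rate f v t = 0
}.

Definition flow_value P f : R := \sum_(v in P) net_outflow f v.

(* Extended-real, because an infinite-capacity path can make the value
   unbounded; otherwise the supremum is the value of a maximum flow. *)
Definition max_flow_value P M : \bar R :=
  ereal_sup [set (flow_value P f)%:E | f in flow_over_time P M]%classic.

(* o(X), for source set [P] and sink set [M] *)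
Definition max_out_flow P M X : \bar R := max_flow_value (P :&: X) (M :\: X).

End FlowsOverTime.

Section Balances.
Variables (K : numDomainType) (V : finType).
Implicit Type b : V -> K.

Definition sources b : {set V} := [set v | 0 < b v].
Definition sinks b : {set V} := [set v | b v < 0].
Definition terminals b : {set V} := sources b :|: sinks b.

End Balances.

Definition feasible (R : realType) (N : network) (b : vertex N -> R) (T : nat)
    : Prop :=
  exists2 f : darc N -> R -> R, flow_over_time T (sources b) (sinks b) f
                             & forall v, net_outflow T f v = b v.

Section Setting.
Variables (R : realType) (N : network) (b : vertex N -> int) (T : nat).
Implicit Type X : {set vertex N}.

Definition balance_in (v : vertex N) : R := (b v)%:~R.

Definition outf X : \bar R := max_out_flow R T (sources b) (sinks b) X.

Definition balance_of X : \bar R := (\sum_(v in X) balance_in v)%:E.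

Definition tight X : Prop := outf X = balance_of X.

(* The extended network; the new node is [None], and so is the new arc, which
   goes from [None] to [s] with capacity [c] and transit time [d]. *)
Definition extend (s : vertex N) (c d : nat) : network :=
  @Network (option (vertex N)) (option (darc N))
    (fun e => if e is Some a then Some (arc_tail a) else None)
    (fun e => if e is Some a then Some (arc_head a) else Some s)
    (fun e => if e is Some a then capacity a else Some c)
    (fun e => if e is Some a then transit a else d).

(* [ss] is the source from which supply is moved to the new node *)
Variables (ss s : vertex N) (Q : {set vertex N}).

Definition old (X : {set vertex N}) : {set option (vertex N)} := [set Some v | v in X].
Definition hat (X : {set vertex N}) : {set option (vertex N)} := None |: old X.

(* The new node counts as a source here whatever the sign of its balance. *)
Definition outf_ext (c d : nat) (Y : {set option (vertex N)}) : \bar R :=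
  @max_out_flow R (extend s c d) T (hat (sources b)) (old (sinks b)) Y.

(* Both terms are finite when [Q] is tight: the new node has no entering arc,
   and its only leaving arc carries at most [c * T] units. *)
Definition Delta (c d : nat) : R :=
  fine (outf_ext c d (hat Q) - outf_ext c d (old Q))%E.

Definition balance_ext (c d : nat) (w : option (vertex N)) : R :=
  if w is Some v then
    if v == ss then balance_in v - Delta c d else balance_in v
  else Delta c d.

Definition slack_ext (c d : nat) (Y : {set option (vertex N)}) : \bar R :=
  (outf_ext c d Y - (\sum_(w in Y) balance_ext c d w)%:E)%E.

Definition slack_tilde (c d : nat) (X : {set option (vertex N)}) : \bar R :=
  slack_ext c d (hat Q :|: X).

Definition feasible_ext (c d : nat) : Prop :=
  @feasible R (extend s c d) (balance_ext c d) T.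

Definition alpha_feasible (alpha : nat) : Prop := feasible_ext alpha 0.
Definition delta_feasible (delta : nat) : Prop := feasible_ext 1 delta.
Definition alpha_slack (alpha : nat) := slack_tilde alpha 0.
Definition delta_slack (delta : nat) := slack_tilde 1 delta.

End Setting.

Definition is_max_nat (P : nat -> Prop) (n : nat) : Prop :=
  P n /\ forall m, P m -> (m <= n)%N.

Definition is_min_nat (P : nat -> Prop) (n : nat) : Prop :=
  P n /\ forall m, P m -> (n <= m)%N.

Section NewtonLoop.
(* [vt p X] is the function examined for the parameter value [p], [extremum] is
   [is_max_nat] or [is_min_nat], and [D] is the ground set of the search.  The
   choice among several minimizers is left open. *)
Variables (R : realType) (W : finType) (vt : nat -> {set W} -> \bar R).
Variables (extremum : (nat -> Prop) -> nat -> Prop) (D : {set W}).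

Definition minimizer (F : {set W} -> \bar R) (family : pred {set W})
    (X : {set W}) : Prop :=
  family X /\ forall Y, family Y -> (F X <= F Y)%E.

Definition loop_body (p : nat) (X : {set W}) (p' : nat) (X' : {set W}) : Prop :=
  extremum (fun q => (0 <= vt q X)%E) p'
  /\ minimizer (vt p') (fun Y => Y \proper X) X'.

(* Every execution of the loop from the state [(p, X)], whatever minimizers are
   chosen, never gets stuck, executes the body at most [n] times, and returns
   [r]. *)
Fixpoint loop_returns (n r p : nat) (X : {set W}) : Prop :=
  if (vt p X < 0)%E then
    if n is m.+1 then
      (exists p' X', loop_body p X p' X')
      /\ (forall p' X', loop_body p X p' X' -> loop_returns m r p' X')
    else False
  else p = r.

Definition newton_returns (p1 n r : nat) : Prop :=
  (exists X1, minimizer (vt p1) (fun Y => Y \subset D) X1)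
  /\ forall X1, minimizer (vt p1) (fun Y => Y \subset D) X1 ->
       loop_returns n r p1 X1.

End NewtonLoop.

(* Main.v *)
(** Transit times are integers, so a flow over time decouples into one static
    flow in the time-expanded network for each fractional part of the time.
    Hence out-flow values are minimum cuts of that network, attained by integral
    flows, and feasibility of a balance is a cut condition (Gale).  In the
    extended network the new arc only adds to a cut [C] the capacity it still
    has towards the copies of [s] outside [C], and so the minimum cuts for
    two parameter values satisfy one exchange inequality, which contains
    submodularity and the monotonicity in the parameter.  Since [ss] reaches [s]
    through an infinite arc, sets containing [ss] do not see the new arc and have
    nonnegative slack.  For the other sets, tightness of [Q] and [Rs] reduces
    feasibility to the sets between [hat Q] and [hat Rs].  A minimizer [X] of
    the slack at one parameter value satisfies
    slack(Y :&: X) <= slack(Y) at every more relaxed value, so the search may be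
    restricted to proper subsets of [X]. *)
Require Import Defs.
From HB Require Import structures.
From mathcomp Require Import all_boot all_order all_algebra.
From mathcomp Require Import all_classical all_reals all_analysis.
From mathcomp Require Import measurable_realfun.
From mathcomp Require Import zify ring lra.
Set Implicit Arguments.
Unset Strict Implicit.
Unset Printing Implicit Defensive.
Import Order.TTheory GRing.Theory Num.Theory.
Local Open Scope ring_scope.

(** * Static flows and cuts *)

Section StaticFlow.
Variables (K : zmodType) (N : network).
Implicit Types (x : darc N -> K) (C : {set vertex N}).

Definition snet x (v : vertex N) : K :=
  \sum_(a | arc_tail a == v) x a - \sum_(a | arc_head a == v) x a.

(** Arcs with both ends in [C] occur once with each sign and cancel. *)
Lemma sum_snet x C : \sum_(v in C) snet x v =
  \sum_(a | (arc_tail a \in C) && (arc_head a \notin C)) x a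
  - \sum_(a | (arc_head a \in C) && (arc_tail a \notin C)) x a.
Proof.
have fiber (h : darc N -> vertex N) :
    \sum_(v in C) \sum_(a | h a == v) x a = \sum_(a | h a \in C) x a.
  rewrite (partition_big h (mem C)) //=; apply: eq_bigr => v vC.
  by apply: eq_bigl => a; case: eqP => [->|]; rewrite ?vC ?andbF.
rewrite big_split /= sumrN !fiber.
rewrite (bigID (fun a => arc_head a \in C)) /=.
rewrite [X in _ - X](bigID (fun a => arc_tail a \in C)) /=.
rewrite opprD addrACA (eq_bigl (fun a => (arc_head a \in C) && (arc_tail a \in C))).
  by rewrite subrr add0r.
by move=> a; rewrite andbC.
Qed.

Lemma snetD x y v : snet (fun a => x a + y a) v = snet x v + snet y v.
Proof. by rewrite /snet !big_split /= opprD addrACA. Qed.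

End StaticFlow.

Lemma snet_morph (K L : zmodType) (h : {additive K -> L}) (N : network)
    (x : darc N -> K) v : snet (fun a => h (x a)) v = h (snet x v).
Proof. by rewrite /snet raddfB !raddf_sum. Qed.

(** * Augmenting paths and Gale's theorem for finite capacities *)

Section Augmentation.
Variables (N : network) (u : darc N -> nat).
Implicit Types (x : darc N -> int) (v w : vertex N).

Definition capped x := forall a, 0 <= x a <= (u a)%:Z.

Definition residual x v w : bool :=
  [exists a, [&& arc_tail a == v, arc_head a == w & x a < (u a)%:Z]]
  || [exists a, [&& arc_head a == v, arc_tail a == w & 0 < x a]].

Lemma snet_arc (e : int) (a : darc N) v :
  snet (fun b => if b == a then e else 0) v =
  e *+ (v == arc_tail a) - e *+ (v == arc_head a).
Proof.
have sum1 (h : darc N -> vertex N) :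
    \sum_(b | h b == v) (if b == a then e else 0) = e *+ (v == h a).
  rewrite -big_mkcondr /=; case: (eqVneq v (h a)) => [->|ne].
    rewrite (big_pred1 a) // => b.
    by apply/andP/eqP => [[_ /eqP]|->].
  rewrite big_pred0 // => b; apply/negP => /andP[/eqP hb /eqP eb].
  by rewrite -hb eb eqxx in ne.
by rewrite /snet !sum1.
Qed.

(** The last conclusion serves the induction. The arc used for the first step has the end [v], which
    is not on the rest of the path, so after pushing along that rest it still carries its original
    flow and has room for one unit. *)
Lemma push_path p x v : capped x -> path (residual x) v p -> uniq (v :: p) ->
  exists2 x', capped x' &
    (forall w, snet x' w = snet x w + (w == v)%:R - (w == last v p)%:R)
    /\ forall a, ~~ ((arc_tail a \in v :: p) && (arc_head a \in v :: p)) ->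
         x' a = x a.
Proof.
elim: p v => [|y p IH] v capx /=.
  by move=> _ _; exists x => //; split => // w; rewrite addrK.
move=> /andP[rvy pyp] /andP[vyp uyp].
have [x1 capx1 [net1 eq1]] := IH y capx pyp uyp.
(* Forward and backward residual arcs are treated at once, with [e] equal to 1 or -1. *)
have push (a : darc N) (e : int) :
    (arc_tail a == v) || (arc_head a == v) ->
    (arc_tail a \in [:: v; y]) && (arc_head a \in [:: v; y]) ->
    0 <= x a + e <= (u a)%:Z ->
    (forall w, e *+ (w == arc_tail a) - e *+ (w == arc_head a)
       = (w == v)%:R - (w == y)%:R) ->
  exists2 x', capped x' &
    (forall w, snet x' w = snet x w + (w == v)%:R - (w == last y p)%:R)
    /\ forall b, ~~ ((arc_tail b \in [:: v, y & p])
         && (arc_head b \in [:: v, y & p])) -> x' b = x b.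
  move=> av ain bnd net.
  exists (fun b => x1 b + (if b == a then e else 0)).
    move=> b; case: eqP => [->|_]; last by rewrite addr0.
    rewrite eq1 //; apply/negP => /andP[tP hP].
    by case/orP: av => /eqP av; rewrite -av ?tP ?hP in vyp.
  split=> [w|b bP].
    by rewrite snetD snet_arc net net1; ring.
  case: eqP => [ba|_].
    move: bP; rewrite ba; case/andP: ain; rewrite !inE.
    by case/orP=> /eqP -> /orP[]/eqP ->; rewrite !eqxx ?orbT.
  rewrite addr0 eq1 //; apply: contra bP.
  by rewrite !(in_cons v) => /andP[-> ->]; rewrite !orbT.
case/orP: rvy => /existsP[a /and3P[/eqP av /eqP ay xa]];
  have /andP[xa0 xau] := capx a.
- apply: (push a 1); rewrite ?av ?ay ?inE ?eqxx ?orbT //.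
  by apply/andP; split; lia.
- apply: (push a (-1)); rewrite ?av ?ay ?inE ?eqxx ?orbT //.
    by apply/andP; split; lia.
  by move=> w; rewrite !mulNrn opprK addrC.
Qed.

(** [C] is what the residual graph reaches from [A]. No residual arc leaves [C], so outgoing arcs
    are saturated and incoming ones are empty. Each vertex of [C] ends a simple residual path, along
    which a unit can be pushed. *)
Lemma residual_cut x (A : {set vertex N}) : capped x ->
  exists2 C : {set vertex N}, A \subset C &
    \sum_(v in C) snet x v =
      \sum_(a | (arc_tail a \in C) && (arc_head a \notin C)) (u a)%:Z
    /\ forall w, w \in C -> exists2 v, v \in A & exists2 x', capped x' &
         forall z, snet x' z = snet x z + (z == v)%:R - (z == w)%:R.
Proof.
move=> capx.
pose C := [set w | [exists v in A, connect (residual x) v w]].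
have closed v w : v \in C -> residual x v w -> w \in C.
  rewrite !inE => /existsP[z /andP[zA zv]] vw; apply/existsP; exists z.
  by rewrite zA (connect_trans zv (connect1 vw)).
exists C.
  apply/fintype.subsetP => v vA; rewrite inE; apply/existsP.
  by exists v; rewrite vA connect0.
split=> [|w].
  rewrite sum_snet [X in _ - X]big1 ?subr0.
    apply: eq_bigr => a /andP[tC hC]; apply/eqP.
    have /andP[_] := capx a; rewrite le_eqVlt => /orP[//|lt].
    case/negP: hC; apply: closed tC _; apply/orP; left.
    by apply/existsP; exists a; rewrite !eqxx.
  move=> a /andP[hC tC]; apply/eqP.
  have /andP[] := capx a; rewrite le_eqVlt => /orP[/eqP <- //|lt] _.
  case/negP: tC; apply: closed hC _; apply/orP; right.
  by apply/existsP; exists a; rewrite !eqxx.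
rewrite inE => /existsP[v /andP[vA /connectP[p pP ->]]].
case: (shortenP pP) => p' p'P p'u _; exists v => //.
by have [x' capx' [net _]] := push_path capx p'P p'u; exists x'.
Qed.

(** Gale's theorem. Starting from the zero flow, the total deviation from [d] is reduced by pushing
    a unit from a vertex that sends too little to one that sends too much, until no vertex of the
    second kind is reachable. *)
Theorem transshipment (d : vertex N -> int) :
  \sum_v d v = 0 ->
  (forall C : {set vertex N}, \sum_(v in C) d v <=
     \sum_(a | (arc_tail a \in C) && (arc_head a \notin C)) (u a)%:Z) ->
  exists2 x, capped x & forall v, snet x v = d v.
Proof.
move=> d0 cut.
suff loop n x : capped x -> (\sum_v `|d v - snet x v|%N <= n)%N ->
    exists2 x', capped x' & forall v, snet x' v = d v.
  by apply: (loop _ (fun=> 0)) (leqnn _) => a; rewrite lexx.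
elim: n x => [|n IH] x capx le_n.
  exists x => // v; move: le_n; rewrite leqn0 sum_nat_eq0 => /forallP/(_ v)/=.
  by rewrite absz_eq0 subr_eq0 => /eqP.
have [C AC [sumC pushC]] := residual_cut [set v | snet x v < d v] capx.
have [/existsP[w /andP[wC dw]]|/existsPn nex] :=
    boolP [exists w in C, d w < snet x w].
  have [v] := pushC w wC; rewrite inE => dv [x' capx' net'].
  apply: (IH x') => //; rewrite -ltnS; apply: leq_trans le_n.
  have vw : v != w by apply/eqP => vw; move: dv dw; rewrite vw; lia.
  rewrite (bigD1 v) //= [X in (_ < X)%N](bigD1 v) //= -addSn.
  apply: leq_add; first by rewrite net' eqxx (negbTE vw); lia.
  apply: leq_sum => z zv; rewrite net' (negbTE zv).
  by case: eqP => [->|_] /=; lia.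
have le_d w : w \in C -> snet x w <= d w.
  by move=> wC; have := nex w; rewrite wC /= -leNgt.
(* The terms are nonnegative, and the cut condition bounds their sum by 0. So no vertex sends too
   little, and as both totals are 0, none sends too much. *)
have eqC : \sum_(v in C) (d v - snet x v) = 0.
  apply/eqP; rewrite eq_le sumr_ge0 => [|v vC]; last by rewrite subr_ge0 le_d.
  by rewrite big_split /= sumrN sumC subr_le0 cut.
have ge_d v : d v <= snet x v.
  rewrite leNgt; apply/negP => lt.
  have vC : v \in C by apply: (fintype.subsetP AC); rewrite inE.
  have := eqC; rewrite (bigD1 v) //= => /eqP; apply/negP.
  rewrite gt_eqF // ltr_pwDl ?subr_gt0 ?sumr_ge0 // => z /andP[zC _].
  by rewrite subr_ge0 le_d.
exists x => // v; apply/eqP; rewrite eq_le ge_d andbT.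
have : \sum_v (snet x v - d v) = 0.
  rewrite big_split /= sumrN d0 oppr0 addr0.
  transitivity (\sum_(v in [set: vertex N]) snet x v).
    by apply: eq_bigl => z; rewrite inE.
  by rewrite sum_snet !big_pred0 ?subr0 // => a; rewrite !inE.
move/eqP; rewrite psumr_eq0 => [|z _]; last by rewrite subr_ge0.
by move=> /allP/(_ v (mem_index_enum v)); rewrite subr_eq0 => /eqP ->.
Qed.

End Augmentation.

Lemma addye_ge0 (R : realType) (x : \bar R) : (0 <= x)%E -> (+oo + x = +oo)%E.
Proof. by case: x. Qed.

Section CutCapacity.
Variables (R : realType) (N : network).
Implicit Types (C : {set vertex N}) (a : darc N).

Definition ecap (o : option nat) : \bar R := if o is Some c then c%:R%:E else +oo%E.

Lemma ecap_ge0 o : (0 <= ecap o)%E.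
Proof. by case: o => [c|] /=; rewrite ?leey ?lee_fin ?ler0n. Qed.

Definition crosses C a := (arc_tail a \in C) && (arc_head a \notin C).

Definition cut_cap C : \bar R := (\sum_(a | crosses C a) ecap (capacity a))%E.

Lemma cut_cap_ge0 C : (0 <= cut_cap C)%E.
Proof. by apply: sume_ge0 => a _; apply: ecap_ge0. Qed.

Lemma sum_ecap_infinite (I : finType) (P : pred I) (u : I -> option nat) i :
  P i -> u i = None -> (\sum_(j | P j) ecap (u j) = +oo)%E.
Proof.
move=> Pi ui; rewrite (bigD1 i) //= ui /= addye_ge0 //.
by apply: sume_ge0 => j _; apply: ecap_ge0.
Qed.

(** [n] is a finite substitute for infinite capacities: a cut of infinite capacity keeps at least
    [n] after the substitution. *)
Lemma cut_capP n C :
  cut_cap C = +oo%E /\ (n <= \sum_(a | crosses C a) odflt n (capacity a))%N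
  \/ cut_cap C = (\sum_(a | crosses C a) odflt n (capacity a))%:R%:E.
Proof.
have [/existsP[a /andP[aC /eqP ua]]|/existsPn fin] :=
    boolP [exists a, crosses C a && (capacity a == None)].
  left; split; first exact: sum_ecap_infinite aC ua.
  by rewrite (bigD1 a) //= ua leq_addr.
right; rewrite natr_sum -sumEFin; apply: eq_bigr => a aC.
by have := fin a; rewrite aC /=; case: (capacity a).
Qed.

Lemma cut_cap_nat C : cut_cap C = +oo%E \/ exists n : nat, cut_cap C = n%:R%:E.
Proof.
by case: (cut_capP 0 C) => [[]|]; [left|right; eexists; eassumption].
Qed.

Lemma snet_cut_le (x : darc N -> R) C : (forall a, 0 <= x a) ->
  (forall a, within_capacity (x a) (capacity a)) ->
  ((\sum_(v in C) snet x v)%:E <= cut_cap C)%E.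
Proof.
move=> x0 xu; rewrite sum_snet.
apply: (@le_trans _ _ (\sum_(a | crosses C a) (x a)%:E)%E).
  by rewrite sumEFin lee_fin gerBl sumr_ge0.
apply: lee_sum => a _; have := xu a.
by case: (capacity a) => [c|] /=; rewrite ?leey ?lee_fin.
Qed.

End CutCapacity.

Arguments ecap R o : clear implicits.
Arguments cut_cap R {N} C.

Definition feasible_int (N : network) (x : darc N -> int) :=
  (forall a, 0 <= x a) /\
  forall a, if capacity a is Some c then x a <= c%:Z else true.

(** No set demands more than the sum of all [|d v|], so this number can replace every infinite
    capacity. *)
Lemma transshipment_inf (R : realType) (N : network) (d : vertex N -> int) :
  \sum_v d v = 0 ->
  (forall C : {set vertex N}, ((\sum_(v in C) d v)%:~R%:E <= cut_cap R C)%E) ->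
  exists2 x, feasible_int x & forall v, snet x v = d v.
Proof.
move=> d0 cut; pose n := (\sum_v `|d v|)%N.
have sum_le (C : {set vertex N}) : \sum_(v in C) d v <= n%:Z.
  apply: (@le_trans _ _ (\sum_(v in C) `|d v|%:Z)).
    by apply: ler_sum => v _; lia.
  rewrite -(big_morph Posz PoszD erefl) lez_nat /n.
  by rewrite [X in (_ <= X)%N](bigID (mem C)) /= leq_addr.
have [C|x capx netx] := @transshipment N (fun a => odflt n (capacity a)) d d0.
  rewrite -(big_morph Posz PoszD erefl).
  case: (cut_capP R n C) => [[_ le_n]|eq_cap].
    by apply: le_trans (sum_le C) _; rewrite lez_nat.
  by have := cut C; rewrite eq_cap lee_fin [X in _ <= X]pmulrn ler_int.
exists x => //; split=> a; have /andP[//] := capx a.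
by case: (capacity a).
Qed.

(** * Transshipment with balances prescribed for groups of nodes *)

Section Star.
Variables (N : network) (V : finType) (g : vertex N -> V) (beta : V -> int).

(* One new node for each group, through which the group's supply or demand is
   distributed without restriction over the nodes of the group. *)
Definition star : network :=
  @Network (V + vertex N)%type (darc N + vertex N)%type
    (fun e => match e with
       | inl a => inr (arc_tail a)
       | inr u => if beta (g u) < 0 then inr u else inl (g u) end)
    (fun e => match e with
       | inl a => inr (arc_head a)
       | inr u => if 0 < beta (g u) then inr u else inl (g u) end)
    (fun e => if e is inl a then capacity a else None)
    (fun=> 0%N).

(** A group of positive balance has arcs to its members and one of negative balance has arcs from
    them. A group of balance 0 only has loops at its own node, which contribute nothing. *)
Lemma snet_star_inr (x : darc star -> int) u :
  snet x (inr u : vertex star) = snet (fun a => x (inl a)) u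
    + (if beta (g u) < 0 then x (inr u) else 0)
    - (if 0 < beta (g u) then x (inr u) else 0).
Proof.
have sum1 (c : pred V) (h : vertex N -> vertex star) :
    (forall w, h w = if c (g w) then inr w else inl (g w)) ->
    \sum_(w | h w == inr u) x (inr w) = if c (g u) then x (inr u) else 0.
  move=> hE; case: ifP => cu.
    rewrite (big_pred1 u) // => w; rewrite hE; case: ifP => // cw.
    by apply/esym/eqP => wu; rewrite -wu cw in cu.
  rewrite big_pred0 // => w; rewrite hE; case: ifP => // cw.
  by apply/eqP => -[wu]; rewrite wu cu in cw.
rewrite /snet !big_sumType /= (sum1 (fun v => beta v < 0)) //.
rewrite (sum1 (fun v => 0 < beta v)) //.
by rewrite opprD addrACA addrA.
Qed.

Lemma snet_star_inl (x : darc star -> int) v :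
  snet x (inl v : vertex star) =
  \sum_(u | g u == v) ((if 0 < beta (g u) then x (inr u) else 0)
                       - (if beta (g u) < 0 then x (inr u) else 0)).
Proof.
have sum1 (c : pred V) (h : vertex N -> vertex star) :
    (forall w, h w = if c (g w) then inr w else inl (g w)) ->
    \sum_(w | h w == inl v) x (inr w) =
    \sum_(w | g w == v) (if c (g w) then 0 else x (inr w)).
  move=> hE; rewrite (eq_bigl (fun w => (g w == v) && ~~ c (g w))) => [|w].
    by rewrite big_mkcondr; apply: eq_bigr => w _; case: (c _).
  by rewrite hE; case: (c _); rewrite ?andbF ?andbT.
rewrite /snet !big_sumType /= [X in X + _ - _]big_pred0 //.
rewrite [X in _ - (X + _)]big_pred0 // !add0r (sum1 (fun v => beta v < 0)) //.
rewrite (sum1 (fun v => 0 < beta v)) //.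
rewrite -sumrN -big_split /=; apply: eq_bigr => u _.
by case: ltgtP => _; rewrite ?subr0 ?sub0r ?subrr.
Qed.

(** Gale's theorem in [star]. A cut crossed by an arc between a group and a member is infinite;
    every other cut satisfies the two closure conditions on [X] and [C]. The orientation of these
    arcs gives the signs of [snet x u]. *)
Theorem grouped_transshipment (R : realType) : \sum_v beta v = 0 ->
  (forall (X : {set V}) (C : {set vertex N}),
     (forall u, g u \in X -> 0 < beta (g u) -> u \in C) ->
     (forall u, u \in C -> beta (g u) < 0 -> g u \in X) ->
     ((\sum_(v in X) beta v)%:~R%:E <= cut_cap R C)%E) ->
  exists2 x : darc N -> int, feasible_int x &
    [/\ forall u, 0 < beta (g u) -> 0 <= snet x u,
        forall u, beta (g u) < 0 -> snet x u <= 0,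
        forall u, beta (g u) = 0 -> snet x u = 0 &
        forall v, \sum_(u | g u == v) snet x u = beta v].
Proof.
move=> beta0 cut.
pose d (w : vertex star) : int := if w is inl v then beta v else 0.
have sumd (P : pred (vertex star)) :
    \sum_(w | P w) d w = \sum_(v | P (inl v)) beta v.
  by rewrite big_sumType /= [X in _ + X]big1 ?addr0.
have [|C|x [x0 xu] netx] := @transshipment_inf R star d.
- by rewrite sumd.
- rewrite sumd; pose X := [set v | inl v \in C]; pose D := [set u | inr u \in C].
  have capC : cut_cap R C = (cut_cap R D
      + \sum_(u | crosses C (inr u : darc star)) ecap R None)%E.
    rewrite /cut_cap big_sumType /=; congr (_ + _)%E.
    by apply: eq_bigl => a; rewrite /crosses !inE.
  have [|nocross] := boolP [exists u, crosses C (inr u : darc star)].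
    case/existsP=> u uC.
    rewrite capC (@sum_ecap_infinite R _ (fun u => crosses C (inr u : darc star))
      (fun=> None) u uC erefl).
    by rewrite addeC addye_ge0 ?leey ?cut_cap_ge0.
  rewrite capC [X in (_ + X)%E]big_pred0 => [|u]; last first.
    by apply/negP => uC; case/existsP: nocross; exists u.
  rewrite adde0; have := cut X D; under eq_bigl do rewrite inE.
  move/existsPn in nocross.
  apply=> u; have := nocross u; rewrite /crosses /= !inE negb_and negbK.
    by move=> + uX bu; rewrite bu lt_gtF // uX.
  by move=> + uC bu; rewrite bu uC lt_gtF.
pose y a := x (inl a).
have nety u : snet y u = (if 0 < beta (g u) then x (inr u) else 0)
    - (if beta (g u) < 0 then x (inr u) else 0).
  apply/eqP; rewrite -subr_eq0 opprB addrA -snet_star_inr.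
  by rewrite netx.
exists y; first by split=> a; [apply: x0|apply: (xu (inl a))].
split=> [u bu|u bu|u bu|v].
- by rewrite nety bu lt_gtF // subr0.
- by rewrite nety bu lt_gtF // sub0r oppr_le0.
- by rewrite nety bu ltxx subrr.
- by rewrite -[RHS](netx (inl v)) snet_star_inl; apply: eq_bigr => u _.
Qed.

End Star.

(** * Slices of a flow over time *)

Section Shift.
Local Open Scope classical_set_scope.
Local Open Scope ring_scope.
Variable R : realType.
Notation mu := (@lebesgue_measure R).
Implicit Types (h : R -> R) (z k : R).

Let shift z : measurableTypeR R -> measurableTypeR R := fun t => t + z.

Let measurable_shift z : measurable_fun setT (shift z).
Proof. exact: measurable_realfun.measurable_funD. Qed.

(** Lebesgue measure is determined by its values on half-open intervals, and translation preserves
    their lengths. *)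
Lemma lebesgue_measure_shift z A : measurable A ->
  pushforward mu (shift z) A = mu A.
Proof.
move=> mA; apply/esym.
have mz := measurable_shift z.
apply: (@lebesgue_measure_unique R (pushforward mu (shift z))) => //=.
move=> _ [[a b]] _ <-; rewrite /pushforward.
have -> : shift z @^-1` `]a, b]%classic = `]a - z, b - z]%classic.
  apply/seteqP; split => t /=; rewrite !in_itv /= /shift;
    by rewrite ltrBlDr lerBrDr.
rewrite !lebesgue_measure_itv /= !lte_fin ltrD2r.
by case: ifP => // _; rewrite -!EFinD; congr (_%:E); ring.
Qed.

Lemma integrable_shift h z : mu.-integrable setT (EFin \o h) ->
  mu.-integrable setT (EFin \o (fun t => h (t + z))).
Proof.
move=> /integrableP[mh hfin].
have mz := measurable_shift z.
apply/integrableP; split.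
  apply/measurable_EFinP.
  by apply: (measurableT_comp _ mz); apply/measurable_EFinP.
apply: le_lt_trans hfin.
rewrite -[X in (X <= _)%E]/(\int[mu]_(x in shift z @^-1` setT)
  ((fun y => `|(h y)%:E|) \o shift z) x)%E.
rewrite -ge0_integral_pushforward //=; last first.
  apply/measurable_EFinP; apply: measurableT_comp => //.
  by apply/measurable_EFinP.
rewrite le_eqVlt; apply/orP; left; apply/eqP.
by apply: eq_measure_integral => A mA _; apply: lebesgue_measure_shift.
Qed.

Lemma Rintegral_shift h k : mu.-integrable setT (EFin \o h) ->
  \int[mu]_(t in `[k, k + 1[) h t = \int[mu]_(t in `[0, 1[) h (t + k).
Proof.
move=> ih; have mk := measurable_shift k.
have ihk := integrable_shift k ih.
have pre : shift k @^-1` `[k, k + 1[%classic = `[0, 1[%classic.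
  apply/seteqP; split => t /=; rewrite !in_itv /= /shift;
    by rewrite lerDr (addrC k) ltrD2r.
rewrite /Rintegral; congr fine.
rewrite -pre.
rewrite -[RHS]/(\int[mu]_(x in shift k @^-1` `[k, (k + 1)%R[)
  ((EFin \o h) \o shift k) x)%E.
rewrite -integral_pushforward //=.
- by apply: eq_measure_integral => A mA _; apply/esym/lebesgue_measure_shift.
- by case/integrableP: ih.
- apply: integrableS ihk => //.
  by rewrite pre; exact: measurable_itv.
Qed.

Lemma Rintegral_slices h (n : nat) : mu.-integrable setT (EFin \o h) ->
  \int[mu]_(t in `[0, n%:R[) h t =
  \sum_(k < n) \int[mu]_(t in `[0, 1[) h (t + k%:R).
Proof.
move=> ih; elim: n => [|n IH].
  by rewrite big_ord0 set_itv_ge ?bnd_simp ?ltxx // Rintegral_set0.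
rewrite big_ord_recr /= -IH -Rintegral_shift //.
have -> : `[0, n.+1%:R[%classic = (`[0, n%:R[ `|` `[n%:R, n%:R + 1[)%classic :> set R.
  rewrite natr1; apply/seteqP; split => t /=; rewrite !in_itv /=.
    by case/andP=> t0 tn; case: (ltP t n%:R) => tn'; [left|right]; rewrite ?t0 ?tn.
  case=> /andP[t0 tn]; first by rewrite t0 (lt_le_trans tn) // ler_nat.
  by rewrite tn (le_trans _ t0).
rewrite Rintegral_setU //.
  by apply: integrableS ih => //; apply: measurableU; exact: measurable_itv.
apply/disj_set2P; rewrite -subset0 => t /=; rewrite !in_itv /=.
by case=> /andP[_ tn] /andP[nt _]; rewrite ltNge nt in tn.
Qed.

Lemma Rintegral_sum (D : set (measurableTypeR R)) (I : Type) (s : seq I) (P : pred I)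
    (F : I -> R -> R) : measurable D ->
  (forall i, mu.-integrable D (EFin \o F i)) ->
  \int[mu]_(t in D) (\sum_(i <- s | P i) F i t) =
  \sum_(i <- s | P i) \int[mu]_(t in D) F i t.
Proof.
move=> mD iF; elim: s => [|i s IH].
  under eq_Rintegral do rewrite big_nil.
  by rewrite big_nil Rintegral_cst // mul0r.
under eq_Rintegral do rewrite big_cons.
rewrite big_cons; case: (P i) => //; rewrite RintegralD ?IH //.
have := @integrable_sum _ _ _ mu D mD I s P (fun i => EFin \o F i) (fun i _ => iF i).
by apply: eq_integrable => // t _ /=; rewrite sumEFin.
Qed.

Lemma integrable_sumR (D : set (measurableTypeR R)) (I : Type) (s : seq I) (P : pred I)
    (F : I -> R -> R) : measurable D ->
  (forall i, mu.-integrable D (EFin \o F i)) ->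
  mu.-integrable D (EFin \o (fun t => \sum_(i <- s | P i) F i t)).
Proof.
move=> mD iF.
have := @integrable_sum _ _ _ mu D mD I s P (fun i => EFin \o F i) (fun i _ => iF i).
by apply: eq_integrable => // t _ /=; rewrite sumEFin.
Qed.

End Shift.

(* An arc that would leave the horizon gets capacity 0, and then its head is
   irrelevant. *)
Definition texp (N : network) (T : nat) : network :=
  @Network (vertex N * 'I_T)%type (darc N * 'I_T)%type
    (fun e => (arc_tail e.1, e.2))
    (fun e => (arc_head e.1, insubd e.2 (e.2 + transit e.1)%N))
    (fun e => if (e.2 + transit e.1 < T)%N then capacity e.1 else Some 0%N)
    (fun=> 0%N).

(** Arcs that would arrive too late have a default head on their own level; the hypothesis makes
    them harmless. What else enters [(v, k)] along [a] departed at step [k - transit a]. *)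
Lemma snet_texp (K : zmodType) (N : network) (T : nat) (x : darc (texp N T) -> K)
    (v : vertex N) (k : 'I_T) :
  (forall a (j : 'I_T), (T <= j + transit a)%N -> x (a, j) = 0) ->
  snet x ((v, k) : vertex (texp N T)) = \sum_(a | arc_tail a == v) x (a, k)
    - \sum_(a | arc_head a == v)
        (if (transit a <= k)%N then x (a, insubd k (k - transit a)%N) else 0).
Proof.
move=> x0; rewrite /snet; congr (_ - _).
  rewrite (reindex_onto (fun a => (a, k)) fst) => [|[a j]] /=.
    by apply: eq_bigl => a; rewrite eqxx andbT /= xpair_eqE eqxx andbT.
  by rewrite xpair_eqE => /andP[_ /eqP <-].
transitivity (\sum_(a | arc_head a == v)
    \sum_(j < T | insubd j (j + transit a)%N == k) x (a, j)).
  by rewrite pair_big_dep /=; apply: eq_big => [[a j]|[a j] _].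
apply: eq_bigr => a _.
have insubdE (j : 'I_T) : (j + transit a < T)%N ->
    (insubd j (j + transit a)%N == k) = (j + transit a == k)%N.
  by move=> jT; rewrite -val_eqE val_insubd jT.
rewrite (bigID (fun j : 'I_T => (j + transit a < T)%N)) /=.
rewrite [X in _ + X]big1 ?addr0 => [|j /andP[_]]; last by rewrite -leqNgt; apply: x0.
case: leqP => ak.
  have kT : (k - transit a < T)%N by rewrite (leq_ltn_trans (leq_subr _ _)).
  rewrite (big_pred1 (insubd k (k - transit a)%N)) // => j.
  have insubk : val (insubd k (k - transit a)%N) = (k - transit a)%N.
    by rewrite val_insubd kT.
  apply/andP/eqP => [[+ jT]|jk].
    by rewrite insubdE // => /eqP jk; apply: val_inj; rewrite insubk /=; lia.
  have {}jk : nat_of_ord j = (k - transit a)%N by rewrite jk.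
  have jT : (j + transit a < T)%N by have := ltn_ord k; lia.
  by split => //; rewrite insubdE //; apply/eqP; lia.
rewrite big_pred0 // => j; apply/negP => /andP[+ jT].
by rewrite insubdE // => /eqP; lia.
Qed.

Section FlowSlices.
Local Open Scope classical_set_scope.
Local Open Scope ring_scope.
Variables (R : realType) (N : network) (T : nat).
Notation mu := (@lebesgue_measure R).
Variable f : darc N -> R -> R.
Hypothesis fint : forall a, mu.-integrable `[0, T%:R[%classic (EFin \o f a).
Hypothesis fhor : forall a t,
  t < 0 \/ T%:R <= t + (transit a)%:R -> f a t = 0.

Let fintT a : mu.-integrable setT (EFin \o f a).
Proof.
have mI : measurable (`[0, T%:R[ : set (measurableTypeR R)).
  exact: measurable_itv.
apply: eq_integrable ((integrable_mkcond _ mI).1 (fint a)) => // t _.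
rewrite patchE; case: ifPn => // /negP nt; rewrite /= fhor //.
case: (ltP t 0) => t0; [by left|right].
rewrite leNgt; apply/negP => tT; apply: nt; apply/mem_set.
by rewrite /= in_itv /= t0 /= (le_lt_trans _ tT) // lerDl ler0n.
Qed.

(** The static flows for the different fractional parts of the time are averaged into a single one.
    As the interval has length 1, capacities bound the average as they bound the rates. *)
Definition slice (e : darc (texp N T)) : R :=
  \int[mu]_(t in `[0, 1[) f e.1 (t + e.2%:R).

Let mI01 : measurable (`[0, 1[%classic : set (measurableTypeR R)).
Proof. exact: measurable_itv. Qed.

Lemma slice_integrable a z :
  mu.-integrable `[0, 1[%classic (EFin \o (fun t => f a (t + z))).
Proof. by apply: integrableS (integrable_shift z (fintT a)). Qed.

Lemma slice_late a (j : 'I_T) : (T <= j + transit a)%N -> slice (a, j) = 0.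
Proof.
move=> jT; rewrite /slice /=.
under eq_Rintegral => t tI.
  rewrite fhor; last first.
    move: tI => /set_mem /=; rewrite in_itv /= => /andP[t0 _]; right.
    by rewrite /= -addrA -natrD (@le_trans _ _ (j + transit a)%:R) ?ler_nat ?lerDr.
  over.
by rewrite Rintegral_cst // mul0r.
Qed.

Lemma net_rate_integrable v : mu.-integrable setT (EFin \o net_rate f v).
Proof.
have it := @integrable_sumR R setT _ (index_enum (darc N))
  (fun a => arc_tail a == v) f measurableT fintT.
have ih := @integrable_sumR R setT _ (index_enum (darc N))
  (fun a => arc_head a == v) _ measurableT
  (fun a => integrable_shift (- (transit a)%:R) (fintT a)).
by have := integrableB measurableT it ih; apply: eq_integrable.
Qed.

(** Integer transit times move unit intervals onto unit intervals, so the integral of the net rate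
    splits into slices. *)
Lemma snet_slice v (k : 'I_T) :
  snet slice ((v, k) : vertex (texp N T)) =
  \int[mu]_(t in `[0, 1[) net_rate f v (t + k%:R).
Proof.
rewrite snet_texp; last exact: slice_late.
have fint01 := slice_integrable.
have it := @integrable_sumR R `[0, 1[%classic _ (index_enum (darc N))
  (fun a => arc_tail a == v) _ mI01 (fun a => slice_integrable a k%:R).
have ih := @integrable_sumR R `[0, 1[%classic _ (index_enum (darc N))
  (fun a => arc_head a == v) _ mI01
  (fun a => slice_integrable a (k%:R - (transit a)%:R)).
under [RHS]eq_Rintegral => t _.
  rewrite /net_rate /tail_rate /head_rate.
  under [X in _ - X]eq_bigr do rewrite -addrA.
  over.
rewrite RintegralB // !Rintegral_sum //; congr (_ - _).
apply: eq_bigr => a _; case: leqP => ak.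
  rewrite /slice val_insubd /= (leq_ltn_trans (leq_subr _ _)) //.
  by rewrite natrB.
(* Here [transit a] exceeds [k]: flow arriving before time [k + 1] would have departed at a negative
   time. *)
under eq_Rintegral => t tI.
  rewrite fhor; last first.
    move: tI => /set_mem /=; rewrite in_itv /= => /andP[_ t1]; left.
    have : k.+1%:R <= (transit a)%:R :> R by rewrite ler_nat.
    rewrite -natr1; lra.
  over.
by rewrite Rintegral_cst // mul0r.
Qed.

Lemma net_outflow_slice v :
  net_outflow T f v = \sum_(k < T) snet slice ((v, k) : vertex (texp N T)).
Proof.
rewrite /net_outflow Rintegral_slices; last exact: net_rate_integrable.
by apply: eq_bigr => k _; rewrite snet_slice.
Qed.

End FlowSlices.

Section FlowToStatic.
Variables (R : realType) (N : network) (T : nat) (P M : {set vertex N}).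
Notation mu := (@lebesgue_measure R).
Variable f : darc N -> R -> R.
Hypothesis fP : flow_over_time T P M f.
Local Open Scope classical_set_scope.
Local Open Scope ring_scope.

Lemma slice_ge0 (e : darc (texp N T)) : 0 <= slice f e.
Proof. by apply: Rintegral_ge0 => t _; apply: flow_ge0 fP _ _. Qed.

Lemma slice_capacity (e : darc (texp N T)) :
  within_capacity (slice f e) (capacity e).
Proof.
case: e => a k /=; case: ltnP => kT; last first.
  by rewrite (slice_late (flow_horizon fP)) //= lexx.
have := fun t => flow_capacity fP a (t + k%:R).
case: (capacity a) => [c|] //= fc.
have -> : c%:R = \int[mu]_(t in `[0, 1[) c%:R :> R.
  rewrite Rintegral_cst; last exact: measurable_itv.
  by rewrite /= lebesgue_measure_itv /= lte_fin ltr01 sube0 mulr1.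
apply: le_Rintegral => //.
- exact: (slice_integrable (flow_integrable fP) (flow_horizon fP)).
- apply: measurable_bounded_integrable => //.
  + by rewrite /= lebesgue_measure_itv /= lte_fin ltr01 sube0 ltry.
  + exact: bounded_cst.
Qed.

Let snetE v (k : 'I_T) :=
  snet_slice (flow_integrable fP) (flow_horizon fP) v k.

Lemma snet_slice_source v (k : 'I_T) : v \in P ->
  0 <= snet (slice f) ((v, k) : vertex (texp N T)).
Proof.
move=> vP; rewrite snetE; apply: Rintegral_ge0 => t _.
exact: flow_source fP _ _ vP.
Qed.

Lemma snet_slice_inner v (k : 'I_T) : v \notin (P :|: M)%SET ->
  snet (slice f) ((v, k) : vertex (texp N T)) = 0.
Proof.
move=> vPM; rewrite snetE.
under eq_Rintegral do rewrite (flow_conservation fP) //.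
by rewrite Rintegral_cst ?mul0r //; exact: measurable_itv.
Qed.

Lemma snet_slice_sink v (k : 'I_T) : v \in M ->
  snet (slice f) ((v, k) : vertex (texp N T)) <= 0.
Proof.
move=> vM; rewrite snetE.
have int0 : \int[mu]_(t in `[0, 1[) 0 = 0 :> R.
  by rewrite Rintegral_cst ?mul0r //; exact: measurable_itv.
rewrite -[leRHS]int0.
apply: le_Rintegral => //.
- apply: integrableS (integrable_shift _
    (net_rate_integrable (flow_integrable fP) (flow_horizon fP) v)) => //.
- apply: integrableS (@integrable0 _ _ _ mu setT) => //.
- by move=> t _; apply: flow_sink fP _ _ vM.
Qed.

End FlowToStatic.

(** * Flows over time from static flows *)

Section StaticToFlow.
Variables (R : realType) (N : network) (T : nat).
Notation mu := (@lebesgue_measure R).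
Variable x : darc (texp N T) -> R.
Hypothesis x0 : forall e, 0 <= x e.
Hypothesis xu : forall e, within_capacity (x e) (capacity e).
Local Open Scope classical_set_scope.
Local Open Scope ring_scope.

(** The same static flow is used for every fractional part of the time. *)
Definition step (a : darc N) (t : R) : R :=
  \sum_(k < T) x (a, k) * \1_(`[k%:R, k%:R + 1[) t.

Lemma step_in a t (k : 'I_T) : k%:R <= t < k%:R + 1 -> step a t = x (a, k).
Proof.
move=> tk; rewrite /step (bigD1 k) //= big1 ?addr0 => [|j jk].
  by rewrite indicE mem_set ?mulr1 //= in_itv.
rewrite indicE memNset ?mulr0 //= in_itv /=.
have /orP[jk'|jk'] : (j < k)%N || (k < j)%N by rewrite -neq_ltn.
  have : j.+1%:R <= k%:R :> R by rewrite ler_nat.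
  by rewrite -natr1 => jk1 /andP[jt tj]; lra.
have : k.+1%:R <= j%:R :> R by rewrite ler_nat.
by rewrite -natr1 => jk1 /andP[jt tj]; lra.
Qed.

Lemma step_out a t : t < 0 \/ T%:R <= t -> step a t = 0.
Proof.
move=> tT; rewrite /step big1 // => k _.
rewrite indicE memNset ?mulr0 //= in_itv /= => /andP[kt tk].
have k0 : 0 <= k%:R :> R by [].
have : k.+1%:R <= T%:R :> R by rewrite ler_nat.
by rewrite -natr1 => kT; case: tT => tT; lra.
Qed.

Lemma itv_step (t : R) : 0 <= t -> t < T%:R ->
  exists k : 'I_T, k%:R <= t < k%:R + 1.
Proof.
move=> t0 tT; have tlt : (Num.truncn t < T)%N by rewrite truncn_lt_nat.
by exists (Ordinal tlt); rewrite /= natr1 truncn_itv.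
Qed.

Lemma static_late a (j : 'I_T) : (T <= j + transit a)%N -> x (a, j) = 0.
Proof.
move=> jT; have := xu (a, j); rewrite /= ltnNge jT /= => xle.
by apply/eqP; rewrite eq_le x0 andbT.
Qed.

Lemma step_late a t : t < 0 \/ T%:R <= t + (transit a)%:R -> step a t = 0.
Proof.
case: (ltP t 0) => [t0 _|t0 [//|tT]]; first by apply: step_out; left.
case: (ltP t T%:R) => tT'; last by apply: step_out; right.
have [k kt] := itv_step t0 tT'; rewrite (step_in a kt) static_late //.
rewrite -ltnS -(ltr_nat R) -natr1 natrD; case/andP: kt; lra.
Qed.

Lemma step_integrable a : mu.-integrable setT (EFin \o step a).
Proof.
apply: integrable_sumR => // k.
apply: eq_integrable (integrableZl _ (x (a, k))
  (integrable_indic_itv _ _ true true)) => //.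
Qed.

Lemma net_rate_step v t (k : 'I_T) : k%:R <= t < k%:R + 1 ->
  net_rate step v t = snet x ((v, k) : vertex (texp N T)).
Proof.
move=> kt; rewrite snet_texp; last exact: static_late.
rewrite /net_rate /tail_rate /head_rate; congr (_ - _).
  by apply: eq_bigr => a _; apply: step_in.
apply: eq_bigr => a _; case: leqP => ak.
  apply: step_in; rewrite val_insubd (leq_ltn_trans (leq_subr _ _)) //.
  by rewrite natrB //; case/andP: kt => ? ?; apply/andP; split; lra.
apply: step_out; left.
have : k.+1%:R <= (transit a)%:R :> R by rewrite ler_nat.
by rewrite -natr1; case/andP: kt; lra.
Qed.

Lemma net_rate_step_out v t : t < 0 \/ T%:R <= t -> net_rate step v t = 0.
Proof.
move=> tT; rewrite /net_rate /tail_rate /head_rate !big1 ?subr0 // => a _.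
  apply: step_late; rewrite subrK; case: tT => tT; [left|by right].
  by apply: le_lt_trans tT; rewrite gerBl.
by apply: step_out.
Qed.

Lemma slice_step : slice step =1 x.
Proof.
case=> a k; rewrite /slice /=; under eq_Rintegral => t tI.
  rewrite (@step_in a _ k); last first.
    move: tI => /set_mem /=; rewrite in_itv /= => /andP[t0 t1].
    by apply/andP; split; lra.
  over.
rewrite Rintegral_cst; last exact: measurable_itv.
by rewrite /= lebesgue_measure_itv /= lte_fin ltr01 sube0 mulr1.
Qed.

Lemma net_outflow_step v :
  net_outflow T step v = \sum_(k < T) snet x ((v, k) : vertex (texp N T)).
Proof.
rewrite net_outflow_slice => [|a|a t].
- apply: eq_bigr => k _; rewrite /snet.
  by congr (_ - _); apply: eq_bigr => e _; rewrite slice_step.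
- exact: integrableS (step_integrable a).
- exact: step_late.
Qed.

Lemma flow_over_time_step (P M : {set vertex N}) :
  (forall v (k : 'I_T), v \in P -> 0 <= snet x ((v, k) : vertex (texp N T))) ->
  (forall v (k : 'I_T), v \in M -> snet x ((v, k) : vertex (texp N T)) <= 0) ->
  (forall v (k : 'I_T), v \notin (P :|: M)%SET ->
     snet x ((v, k) : vertex (texp N T)) = 0) ->
  flow_over_time T P M step.
Proof.
move=> xP xM xPM.
(* A property of 0 and of the static values at all levels holds at all times, since the rates are
   constant on each time step and vanish outside the horizon. [net] and [rate] use this for nodes
   and arcs. *)
have net (Z : R -> Prop) v : Z 0 ->
    (forall k : 'I_T, Z (snet x ((v, k) : vertex (texp N T)))) ->
    forall t, Z (net_rate step v t).
  move=> Z0 Zx t; case: (ltP t 0) => t0; first by rewrite net_rate_step_out //; left.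
  case: (ltP t T%:R) => tT; last by rewrite net_rate_step_out //; right.
  by have [k kt] := itv_step t0 tT; rewrite (net_rate_step v kt).
have rate (Z : R -> Prop) a : Z 0 ->
    (forall k : 'I_T, (k + transit a < T)%N -> Z (x (a, k))) ->
    forall t, Z (step a t).
  move=> Z0 Zx t; case: (ltP t 0) => t0; first by rewrite step_out //; left.
  case: (ltP t T%:R) => tT; last by rewrite step_out //; right.
  have [k kt] := itv_step t0 tT; rewrite (step_in a kt).
  by case: (ltnP (k + transit a) T) => kT; [apply: Zx|rewrite static_late].
split.
- by move=> a; apply: integrableS (step_integrable a).
- by move=> a t; apply: (rate (fun r => 0 <= r)).
- move=> a t; apply: (rate (fun r => within_capacity r (capacity a))).
    by case: (capacity a) => /=.
  by move=> k kT; have := xu (a, k); rewrite /= kT.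
- exact: step_late.
- by move=> v t vP; apply: (net (fun r => 0 <= r)) => // k; apply: xP.
- by move=> v t vM; apply: (net (fun r => r <= 0)) => // k; apply: xM.
- by move=> v t vPM; apply: (net (fun r => r = 0)) => // k; apply: xPM.
Qed.

End StaticToFlow.

(** * Minimum cuts of the time-expanded network *)

Section Cuts.
Variables (R : realType) (N : network) (T : nat).
Implicit Types (P M X : {set vertex N}) (C : {set vertex (texp N T)}).

Definition separates P M C : bool :=
  [forall u : vertex (texp N T),
     ((u.1 \in P) ==> (u \in C)) && ((u.1 \in M) ==> (u \notin C))].

Lemma separatesP P M C :
  reflect ((forall v k, v \in P -> (v, k) \in C)
           /\ (forall v k, v \in M -> (v, k) \notin C)) (separates P M C).
Proof.
apply: (iffP forallP) => [sep|[sP sM] [v k]].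
  by split=> v k vPM; have /andP[/implyP s1 /implyP s2] := sep (v, k); auto.
by apply/andP; split; apply/implyP => /= vPM; auto.
Qed.

(** The sums over the copies of [X] and over [C] are compared vertex by vertex. They can differ only
    at sources outside [X], which can only add to the sum over [C], and at sinks in [X], which can
    only lower the sum over [X]. *)
Lemma net_outflow_le_cut P M X C f : flow_over_time T P M f ->
  separates (P :&: X) (M :\: X) C ->
  ((\sum_(v in X) net_outflow T f v)%:E <= cut_cap R C)%E.
Proof.
move=> fP /separatesP[sP sM].
apply: le_trans (@snet_cut_le R (texp N T) (slice f) C
  (slice_ge0 fP) (slice_capacity fP)).
rewrite lee_fin.
under eq_bigr do rewrite (net_outflow_slice (flow_integrable fP) (flow_horizon fP)).
rewrite pair_big_dep /= big_mkcond [leRHS]big_mkcond /=; apply: ler_sum => -[v k] _ /=.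
rewrite andbT.
have [vP|vP] := boolP (v \in P).
  have s0 := snet_slice_source fP k vP.
  case: ifP => vX; first by rewrite sP // inE vP.
  by case: ifP.
have [vM|vM] := boolP (v \in M).
  have s0 := snet_slice_sink fP k vM.
  case: ifPn => vX; first by case: ifP.
  by rewrite ifN // sM // inE vM vX.
by rewrite (snet_slice_inner fP) ?if_same // inE negb_or vP vM.
Qed.

(** Groups give two results in one: singleton groups prescribe the balance of each node, while
    grouping all sources and all sinks prescribes the value of a flow. *)
Lemma flow_of_cuts (G : finType) (g : vertex N -> G) (beta : G -> int) :
  \sum_c beta c = 0 ->
  (forall (X : {set G}) C,
     separates [set v | (g v \in X) && (0 < beta (g v))]
               [set v | (g v \notin X) && (beta (g v) < 0)] C ->
     ((\sum_(c in X) beta c)%:~R%:E <= cut_cap R C)%E) ->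
  exists2 f : darc N -> R -> R,
    flow_over_time T [set v | 0 < beta (g v)] [set v | beta (g v) < 0] f
    & forall c, \sum_(v | g v == c) net_outflow T f v = (beta c)%:~R.
Proof.
move=> beta0 cut.
have [X C sP sM|x [x0 xu] [xP xM xI xS]] :=
    @grouped_transshipment (texp N T) G (fun u => g u.1) beta R beta0.
  apply: cut; apply/separatesP; split=> v k; rewrite inE => /andP[vX bv].
    exact: sP.
  by apply: contra vX => /sM; apply.
pose y e : R := (x e)%:~R.
have y0 e : 0 <= y e by rewrite ler0z.
have yu e : within_capacity (y e) (capacity e).
  have := xu e; rewrite /within_capacity.
  by case: (capacity e) => // c xc; rewrite [leRHS]pmulrn ler_int.
have nety u : snet y u = (snet x u)%:~R by exact: (snet_morph intr).
exists (step y).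
  apply: flow_over_time_step => // v k; rewrite !inE nety.
  - by move=> bv; rewrite ler0z xP.
  - by move=> bv; rewrite lerz0 xM.
  - rewrite negb_or -!leNgt => bv; rewrite xI //.
    by apply/eqP; rewrite eq_le.
move=> c; rewrite -xS rmorph_sum /=.
under eq_bigr do rewrite (net_outflow_step y0 yu).
rewrite pair_big_dep /=; apply: eq_big => [[v k]|[v k] _] /=; first by rewrite andbT.
by rewrite nety.
Qed.

(** A node of [P] outside [P'] is not in [M] by disjointness, so it conserves flow, and similarly
    for [M]. This covers flows of prescribed value 0, which are constructed with no sources and no
    sinks. *)
Lemma flow_over_time_sub P M P' M' (f : darc N -> R -> R) : [disjoint P & M] ->
  P' \subset P -> M' \subset M -> flow_over_time T P' M' f ->
  flow_over_time T P M f.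
Proof.
move=> PM /fintype.subsetP PP /fintype.subsetP MM fP; split.
- exact: flow_integrable fP.
- exact: flow_ge0 fP.
- exact: flow_capacity fP.
- exact: flow_horizon fP.
- move=> v t vP; have [vP'|vP'] := boolP (v \in P'); first exact: flow_source fP _ _ vP'.
  rewrite (flow_conservation fP) // inE negb_or vP' /=.
  by apply/negP => /MM vM; move: (disjointFr PM vP); rewrite vM.
- move=> v t vM; have [vM'|vM'] := boolP (v \in M'); first exact: flow_sink fP _ _ vM'.
  rewrite (flow_conservation fP) // inE negb_or vM' andbT.
  by apply/negP => /PP vP; move: (disjointFr PM vP); rewrite vM.
- move=> v t; rewrite inE negb_or => /andP[vP vM].
  apply: (flow_conservation fP); rewrite inE negb_or.
  by rewrite (contra (PP v)) // (contra (MM v)).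
Qed.

Lemma flow_with_value P M (n : nat) : [disjoint P & M] ->
  (forall C, separates P M C -> (n%:R%:E <= cut_cap R C)%E) ->
  exists2 f, flow_over_time T P M f & @flow_value R N T P f = n%:R.
Proof.
move=> PM cut.
pose g v := if v \in P then Some true else if v \in M then Some false else None.
pose beta (c : option bool) : int :=
  if c is Some s then (if s then n%:Z else - n%:Z) else 0.
have sumb (X : {set option bool}) : \sum_(c in X) beta c =
    n%:Z *+ (Some true \in X) - n%:Z *+ (Some false \in X).
  rewrite big_mkcond (bigD1 (Some true)) // (bigD1 (Some false)) //=.
  rewrite big1 ?addr0; last by move=> [[]|] //= _; rewrite if_same.
  by case: (_ \in _); case: (_ \in _).
have gP v : (g v == Some true) = (v \in P).
  by rewrite /g; case: ifP => // _; case: ifP.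
have gM v : v \in M -> g v = Some false.
  by move=> vM; rewrite /g (disjointFl PM vM) vM.
have [|X C sep|f fP fv] := @flow_of_cuts _ g beta.
- transitivity (\sum_(c in [set: option bool]) beta c).
    by apply: eq_bigl => c; rewrite inE.
  by rewrite sumb !inE subrr.
(* Only a set that contains the group of the sources and not that of the sinks has positive
   demand. *)
- rewrite sumb; have [->|n0] := posnP n.
    by rewrite !mul0rn subrr cut_cap_ge0.
  have [tX|tX] := boolP (Some true \in X); last first.
    rewrite sub0r; apply: le_trans (cut_cap_ge0 _ _).
    by rewrite lee_fin lerz0 oppr_le0; case: (_ \in X).
  have [fX|fX] := boolP (Some false \in X); first by rewrite subrr cut_cap_ge0.
  rewrite subr0; apply: cut; move/separatesP: sep => [sP sM].
  apply/separatesP; split=> v k v_in; [apply: sP|apply: sM]; rewrite inE.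
    by move: v_in; rewrite -gP => /eqP ->; rewrite tX.
  by rewrite (gM _ v_in) fX /= oppr_lt0.
exists f; last first.
  by rewrite /flow_value -[RHS](fv (Some true)); apply: eq_bigl => v; rewrite gP.
apply: flow_over_time_sub fP => //; apply/fintype.subsetP => v; rewrite inE /g.
  by case: ifP => // _; case: ifP => //= _; rewrite oppr_gt0.
by case: ifP => //= _; case: ifP.
Qed.

(** Cut capacities are natural numbers or infinite. A finite minimum is the value of some flow; if
    the minimum is infinite, there are flows of every natural value. *)
Theorem max_flow_min_cut P M : [disjoint P & M] ->
  (forall C, separates P M C -> (max_flow_value R T P M <= cut_cap R C)%E)
  /\ exists2 C, separates P M C & max_flow_value R T P M = cut_cap R C.
Proof.
move=> PM.
have le_cut C : separates P M C -> (max_flow_value R T P M <= cut_cap R C)%E.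
  move=> sep; apply: ge_ereal_sup => _ [f fP <-].
  apply: (net_outflow_le_cut fP); move/separatesP: sep => [sP sM].
  by apply/separatesP; split=> v k; rewrite inE => /andP[? ?]; [apply: sP|apply: sM].
split=> //.
pose C0 : {set vertex (texp N T)} := [set u | u.1 \in P].
have sep0 : separates P M C0.
  apply/separatesP; split=> v k; rewrite inE //= => vM.
  by rewrite (disjointFl PM vM).
case: (Order.TotalTheory.arg_minP (fun C => cut_cap R C) sep0) => C sepC minC.
exists C => //; apply/eqP; rewrite eq_le le_cut //=.
have value n : (n%:R%:E <= cut_cap R C)%E -> (n%:R%:E <= max_flow_value R T P M)%E.
  move=> le_n; have [C' sC'|f fP fn] := flow_with_value (n := n) PM.
    exact: le_trans le_n (minC _ sC').
  by apply: ereal_sup_ubound; exists f => //; rewrite fn.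
case: (cut_cap_nat R C) => [eqC|[n eqC]]; last first.
  by rewrite eqC; apply: value; rewrite eqC.
rewrite eqC leye_eq; apply/eqP/eqyP => A _.
apply: le_trans (value (Num.truncn A).+1 _); last by rewrite eqC leey.
by rewrite lee_fin ltW // truncnS_gt.
Qed.

Lemma feasible_le_cut (b : vertex N -> R) X C : feasible b T ->
  separates (sources b :&: X) (sinks b :\: X) C ->
  ((\sum_(v in X) b v)%:E <= cut_cap R C)%E.
Proof.
move=> [f fP fb] sep; have := net_outflow_le_cut fP sep.
by under eq_bigr do rewrite fb.
Qed.

Lemma feasible_of_cuts (beta : vertex N -> int) : \sum_v beta v = 0 ->
  (forall X C, separates (sources beta :&: X) (sinks beta :\: X) C ->
     ((\sum_(v in X) beta v)%:~R%:E <= cut_cap R C)%E) ->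
  feasible (fun v => (beta v)%:~R : R) T.
Proof.
move=> beta0 cut; have [X C sep|f fP fb] := @flow_of_cuts _ id beta beta0.
  apply: cut; congr (separates _ _ C): sep; apply/setP => v;
    by rewrite !inE andbC.
exists f => [|v]; last by rewrite -fb (big_pred1 v) // => w; rewrite eq_sym.
congr (flow_over_time T _ _ f): fP; apply/setP => v; rewrite !inE.
  by rewrite ltr0z.
by rewrite ltrz0.
Qed.

End Cuts.

(** * Cuts of the extended network *)

Section OldHat.
Variable N : network.
Implicit Types (X : {set vertex N}) (v : vertex N).

Lemma in_old v X : (Some v \in old X) = (v \in X).
Proof. by rewrite mem_imset // => ? ? []. Qed.

Lemma in_oldN X : (None \in old X) = false.
Proof. by apply/imsetP => -[]. Qed.

Lemma in_hat v X : (Some v \in hat X) = (v \in X).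
Proof. by rewrite inE inE in_old. Qed.

Lemma in_hatN X : None \in hat X.
Proof. by rewrite !inE. Qed.

End OldHat.

Lemma big_option (K : Type) (idx : K) (op : Monoid.com_law idx) (I : finType)
    (F : option I -> K) :
  \big[op/idx]_o F o = op (F None) (\big[op/idx]_i F (Some i)).
Proof.
rewrite (bigD1 None) //=; congr (op _ _).
rewrite (reindex_omap Some id); last by case.
by apply: eq_bigl => i; rewrite /= eqxx.
Qed.

Section ExtendedCuts.
Variables (R : realType) (N : network) (b : vertex N -> int) (T : nat).
Variable s : vertex N.
Implicit Types (X A B : {set vertex N}) (C : {set vertex (texp N T)}).

(* The capacity of an arc entering [s] with capacity [c] and transit time [d] that
   is still available towards the copies of [s] outside of the cut. *)
Definition extra (c d : nat) C : nat :=
  \sum_(j < T | (d <= j)%N && ((s, j) \notin C)) c.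

Definition ext_cut (c d : nat) C : \bar R := (cut_cap R C + (extra c d C)%:R%:E)%E.

Definition sep X C := separates (sources b :&: X) (sinks b :\: X) C.

(** A relation, so that [outf] and [outf_ext] can both be shown to satisfy it and then be identified
    by uniqueness. *)
Definition min_cut (c d : nat) X (o : \bar R) : Prop :=
  (forall C, sep X C -> (o <= ext_cut c d C)%E)
  /\ exists2 C, sep X C & o = ext_cut c d C.

Lemma cut_cap_submodular C D :
  (cut_cap R (C :&: D) + cut_cap R (C :|: D) <= cut_cap R C + cut_cap R D)%E.
Proof.
rewrite /cut_cap !(big_mkcond (crosses _)) -!big_split /=; apply: lee_sum => a _.
rewrite /crosses !inE; have := ecap_ge0 R (@capacity (texp N T) a).
set w := ecap R _ => w0; do 4? [case: (_ \in _)];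
  by rewrite /= ?adde0 ?add0e ?adde_ge0 ?leeDl ?leeDr.
Qed.

(** The two sides differ only at copies of [s] in [C] but not in [D], which are charged for [(c, d)]
    on the left and for [(c', d')] on the right. *)
Lemma extra_exchange c d c' d' C D : (c <= c')%N -> (d' <= d)%N ->
  (extra c d (C :&: D) + extra c' d' (C :|: D) <= extra c d C + extra c' d' D)%N.
Proof.
move=> cc dd; rewrite /extra !(big_mkcond (fun j : 'I_T => _ && _)) -!big_split /=.
apply: leq_sum => j _; rewrite !inE.
have [dj|dj] := leqP d j; have [dj'|dj'] := leqP d' j;
  case: (_ \in C); case: (_ \in D) => //=; lia.
Qed.

(* [c <= c'] and [d' <= d] say that the second parameter pair is the stricter one;
   for equal pairs this is submodularity. *)
Lemma min_cut_exchange c d c' d' A B o1 o2 o3 o4 : (c <= c')%N -> (d' <= d)%N ->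
  min_cut c d (A :&: B) o1 -> min_cut c' d' (A :|: B) o2 ->
  min_cut c d B o3 -> min_cut c' d' A o4 -> (o1 + o2 <= o3 + o4)%E.
Proof.
move=> cc dd [+ _] [+ _] [_ [C sC ->]] [_ [D sD ->]].
move=> /(_ (C :&: D)) le1 /(_ (C :|: D)) le2.
move/separatesP: sC => [CP CM]; move/separatesP: sD => [DP DM].
apply: (@le_trans _ _ (ext_cut c d (C :&: D) + ext_cut c' d' (C :|: D))%E).
  apply: leeD; [apply: le1|apply: le2]; apply/separatesP; split=> v k.
  - by rewrite !inE => /and3P[vP vA vB]; rewrite CP ?DP // !inE vP.
  - rewrite !inE negb_and => /andP[/orP[] vn vM]; rewrite negb_and.
      by rewrite (DM v k) ?orbT // !inE vn.
    by rewrite (CM v k) // !inE vn.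
  - rewrite !inE => /andP[vP /orP[vA|vB]].
      by rewrite (DP v k) ?orbT // !inE vP.
    by rewrite (CP v k) // !inE vP.
  - rewrite !inE !negb_or => /andP[/andP[vA vB] vM].
    by rewrite CM ?DM // !inE ?vA ?vB.
rewrite /ext_cut addeACA [leRHS]addeACA; apply: leeD.
  exact: cut_cap_submodular.
by rewrite -!EFinD lee_fin -!natrD ler_nat extra_exchange.
Qed.

Lemma min_cut_unique c d X o o' : min_cut c d X o -> min_cut c d X o' -> o = o'.
Proof.
move=> [le1 [C sC oC]] [le2 [D sD oD]]; apply/eqP; rewrite eq_le.
by rewrite {1}oD le1 //= oC le2.
Qed.

Lemma min_cut_nat c d X o : min_cut c d X o ->
  o = +oo%E \/ exists n : nat, o = n%:R%:E.
Proof.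
move=> [_ [C _ ->]]; rewrite /ext_cut.
have [->|[n ->]] := cut_cap_nat R C; [left|right] => //.
by exists (n + extra c d C)%N; rewrite natrD EFinD.
Qed.

Lemma sources_sinks_disjoint X Y :
  [disjoint sources b :&: X & sinks b :\: Y].
Proof.
rewrite disjoint_subset; apply/fintype.subsetP => v; rewrite !inE => /andP[b0 _].
by rewrite negb_and (lt_gtF b0) orbT.
Qed.

Lemma min_cut_outf c d X : (forall C, sep X C -> ext_cut c d C = cut_cap R C) ->
  min_cut c d X (outf R b T X).
Proof.
move=> extE.
have [le_cut [C sC eqC]] := max_flow_min_cut R T (sources_sinks_disjoint X X).
split=> [D sD|]; first by rewrite extE //; apply: le_cut.
by exists C => //; rewrite extE.
Qed.

Lemma ext_cut_idle c d C : c = 0%N \/ (T <= d)%N -> ext_cut c d C = cut_cap R C.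
Proof.
move=> idle; rewrite /ext_cut /extra big1 ?adde0 // => j /andP[dj _].
by case: idle => // Td; have := ltn_ord j; lia.
Qed.

Section Extension.
Variables c d : nat.
Local Notation N' := (extend s c d).
Implicit Type D : {set vertex (texp N' T)}.

Definition down D : {set vertex (texp N T)} := [set u | (Some u.1, u.2) \in D].

Lemma cut_cap_ext D : cut_cap R D = (cut_cap R (down D) +
  \sum_(k < T | crosses D (None, k))
    ecap R (if (k + d < T)%N then Some c else Some 0%N))%E.
Proof.
rewrite /cut_cap big_mkcond.
rewrite (eq_bigr (fun e => (fun o k => if crosses D (o, k)
  then ecap R (@capacity (texp N' T) (o, k)) else 0%E) e.1 e.2)); last by case.
rewrite -(pair_bigA _ (fun o k => if crosses D (o, k)
  then ecap R (@capacity (texp N' T) (o, k)) else 0%E)) /=.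
rewrite big_option [RHS]addeC; congr (_ + _)%E; first by rewrite [RHS]big_mkcond.
rewrite pair_bigA [RHS]big_mkcond; apply: eq_bigr => -[a k] _ /=.
by rewrite /crosses !inE.
Qed.

(** [extra] counts by arrival time at [s], the arcs of the time-expanded network by departure time;
    [h] translates the first into the second. *)
Lemma extra_ext D : extra c d (down D) = \sum_(k < T |
  (k + d < T)%N && ((Some s, insubd k (k + d)%N) \notin D)) c.
Proof.
pose h (j : 'I_T) : 'I_T := insubd j (j - d)%N.
have hE j : val (h j) = (j - d)%N.
  by rewrite val_insubd (leq_ltn_trans (leq_subr _ _)).
have h'E (k : 'I_T) : (k + d < T)%N -> val (insubd k (k + d)%N) = (k + d)%N.
  by move=> kT; rewrite val_insubd kT.
rewrite [RHS](reindex_onto h (fun k => insubd k (k + d)%N)) /=; last first.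
  by move=> k /andP[kT _]; apply: val_inj; rewrite hE h'E // addnK.
rewrite /extra; apply: eq_bigl => j; rewrite inE /=.
have [dj|dj] := leqP d j.
  have jdT : (h j + d < T)%N by rewrite [nat_of_ord (h j)]hE subnK.
  have hj : insubd (h j) (h j + d)%N = j.
    by apply: val_inj; rewrite h'E // [nat_of_ord (h j)]hE subnK.
  by rewrite jdT hj eqxx andbT.
apply/esym/negP => /andP[/andP[jT _] /eqP jE].
by have := h'E _ jT; rewrite jE /= [nat_of_ord (h j)]hE; lia.
Qed.

Lemma cut_cap_full D : (forall k, (None, k) \in D) ->
  cut_cap R D = ext_cut c d (down D).
Proof.
move=> DN; rewrite cut_cap_ext /ext_cut extra_ext; congr (_ + _)%E.
rewrite natr_sum -sumEFin big_mkcond [RHS]big_mkcond; apply: eq_bigr => k _.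
by rewrite /crosses DN /=; case: ltnP => kT //=; rewrite ?if_same.
Qed.

Lemma cut_cap_none D : (forall k, (None, k) \notin D) ->
  cut_cap R D = cut_cap R (down D).
Proof.
move=> DN; rewrite cut_cap_ext big_pred0 ?adde0 // => k.
by rewrite /crosses (negbTE (DN k)).
Qed.

Lemma cut_cap_down D : (cut_cap R (down D) <= cut_cap R D)%E.
Proof.
by rewrite cut_cap_ext leeDl //; apply: sume_ge0 => k _; apply: ecap_ge0.
Qed.

Lemma ext_disjoint (Y : {set vertex N'}) :
  [disjoint hat (sources b) :&: Y & old (sinks b) :\: Y].
Proof.
rewrite disjoint_subset; apply/fintype.subsetP => v.
by rewrite [v \in _ :&: _]inE => /andP[_ vY]; rewrite !inE vY.
Qed.

(** The new node is now a source inside the set, so all its copies lie in every separating cut. Such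
    a cut is determined by its trace on the old network. *)
Lemma min_cut_hat X : min_cut c d X (outf_ext R b T s c d (hat X)).
Proof.
have [le_cut [D /separatesP[sP sM] eqD]] :=
  @max_flow_min_cut R N' T _ _ (ext_disjoint (hat X)).
split=> [C /separatesP[CP CM]|]; last first.
  have DN k : (None, k) \in D by apply: sP; rewrite inE !in_hatN.
  exists (down D); last by rewrite /outf_ext /max_out_flow eqD cut_cap_full.
  apply/separatesP; split=> v k; rewrite !inE => /andP[v1 v2].
    by apply: sP; rewrite inE !in_hat !inE v1.
  by apply: sM; rewrite inE in_hat v1 in_old !inE.
pose D' : {set vertex (texp N' T)} :=
  [set u | if u.1 is Some v then (v, u.2) \in C else true].
have D'C : down D' = C by apply/setP => -[v k]; rewrite !inE.
have D'N k : (None, k) \in D' by rewrite inE.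
rewrite -D'C -cut_cap_full //; apply: le_cut.
apply/separatesP; split=> -[v|] k.
- rewrite finset.in_setI !in_hat [_ \in D']inE => /andP[vP vX].
  by apply: CP; rewrite inE vP.
- by [].
- rewrite finset.in_setD in_hat in_old [_ \in D']inE => /andP[vX vM].
  by apply: CM; rewrite inE vX.
- by rewrite finset.in_setD in_oldN andbF.
Qed.

(** Outside the set, the new node need not be in the cut, and leaving its copies out makes the new
    arc free. Conversely, restricting a cut to the old network does not increase its capacity. *)
Lemma outf_old X : outf_ext R b T s c d (old X) = outf R b T X.
Proof.
have [le_cut [D /separatesP[sP sM] eqD]] :=
  @max_flow_min_cut R N' T _ _ (ext_disjoint (old X)).
have [le_cut' [C /separatesP[CP CM] eqC]] :=
  max_flow_min_cut R T (sources_sinks_disjoint X X).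
apply/eqP; rewrite eq_le; apply/andP; split.
  rewrite [leRHS]eqC.
  pose D' : {set vertex (texp N' T)} :=
    [set u | if u.1 is Some v then (v, u.2) \in C else false].
  have D'C : down D' = C by apply/setP => -[v k]; rewrite !inE.
  have D'N k : (None, k) \notin D' by rewrite inE.
  rewrite -D'C -cut_cap_none //; apply: le_cut.
  apply/separatesP; split=> -[v|] k.
  - rewrite finset.in_setI in_hat in_old [_ \in D']inE => /andP[vP vX].
    by apply: CP; rewrite inE vP.
  - by rewrite finset.in_setI in_oldN andbF.
  - rewrite finset.in_setD !in_old [_ \in D']inE => /andP[vX vM].
    by apply: CM; rewrite inE vX.
  - by rewrite finset.in_setD !in_oldN.
rewrite [leRHS]eqD; apply: le_trans (cut_cap_down D); apply: le_cut'.
apply/separatesP; split=> v k; rewrite !inE => /andP[v1 v2].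
  by apply: sP; rewrite inE in_hat in_old !inE v1.
by apply: sM; rewrite inE !in_old !inE v1.
Qed.

End Extension.
End ExtendedCuts.

(** * The Newton loop *)

Section Newton.
Variables (R : realType) (W : finType) (vt : nat -> {set W} -> \bar R).
Variables (stricter : rel nat) (extremum : (nat -> Prop) -> nat -> Prop).
Variables (D : {set W}) (feas : nat -> Prop).
Implicit Types (X Y : {set W}) (p q : nat).
Hypothesis stricter_anti : antisymmetric stricter.
Hypothesis stricter_total : total stricter.
Hypothesis extremumP : forall P p,
  extremum P p <-> P p /\ forall q, P q -> stricter p q.
Hypothesis feasP : forall p, feas p <-> forall X, X \subset D -> (0 <= vt p X)%E.
Hypothesis vt0 : forall p, (0 <= vt p finset.set0)%E.
Hypothesis vt_mono : forall p q X, stricter p q -> (0 <= vt p X)%E -> (0 <= vt q X)%E.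
Hypothesis vt_extremum : forall p X, (vt p X < 0)%E ->
  exists q, extremum (fun q => (0 <= vt q X)%E) q.
Hypothesis vt_nest : forall p q X Y, stricter p q -> X \subset D -> Y \subset D ->
  (vt p X < 0)%E -> (vt p X <= vt p (X :|: Y))%E ->
  (vt q (Y :&: X) <= vt q Y)%E \/ (0 <= vt q Y)%E.

Lemma minimizer_exists (F : {set W} -> \bar R) (family : pred {set W}) X0 :
  family X0 -> exists X, minimizer F family X.
Proof.
move=> fX0; case: (Order.TotalTheory.arg_minP F fX0) => X fX minX.
by exists X; split.
Qed.

(** The invariant: [p] is at least as strict as every feasible value, and [X] is a minimizer apart
    from sets of nonnegative slack. When the slack of [X] is nonnegative, [p] is thus feasible and
    extremal. The size of [X] bounds the remaining iterations. *)
Lemma loop_returns_extremum r n p X :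
  extremum feas r -> X \subset D -> (#|X| <= n)%N ->
  (forall q, feas q -> stricter p q) ->
  (forall Y, Y \subset D -> (vt p X <= vt p Y)%E \/ (0 <= vt p Y)%E) ->
  loop_returns vt extremum n r p X.
Proof.
move=> rP; elim: n p X => [|n IH] p X XD cardX feas_le minX;
  have stop : (0 <= vt p X)%E -> p = r by
    move=> pX; move/extremumP: rP => [rf rmin]; apply: stricter_anti;
    rewrite feas_le // rmin //; apply/feasP => Y YD;
    case: (minX Y YD) => //; exact: le_trans.
  have X0 : X = finset.set0 by apply/eqP; rewrite -cards_eq0 -leqn0.
  by rewrite /= X0 ltNge vt0 /= stop // X0.
rewrite /=; case: ltP => [neg|/stop//].
(* The next value is more relaxed: otherwise monotonicity would make the slack of [X] at [p]
   nonnegative. *)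
have step q : extremum (fun q => (0 <= vt q X)%E) q -> stricter p q.
  move=> /extremumP[qX _]; case/orP: (stricter_total p q) => // qp.
  by have := vt_mono qp qX; rewrite leNgt neg.
split.
  have [q qX] := vt_extremum neg.
  have [|X' X'P] := @minimizer_exists (vt q) (fun Y => Y \proper X) finset.set0.
    rewrite proper0; apply/eqP => X0.
    by move: neg; rewrite X0 ltNge vt0.
  by exists q, X'.
move=> q X' [qX [X'X minX']].
have X'D := fintype.subset_trans (proper_sub X'X) XD.
apply: IH => // [||Y YD].
- by rewrite -ltnS; apply: leq_trans cardX; apply: proper_card.
- move=> m mf; move/extremumP: (qX) => [_]; apply.
  by move/feasP: mf; apply.
have negU : (vt p X <= vt p (X :|: Y))%E.
  have UD : X :|: Y \subset D by rewrite finset.subUset XD.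
  have [//|pos] := minX _ UD.
  exact: ltW (lt_le_trans neg pos).
case: (vt_nest (step q qX) XD YD neg negU) => [le|]; last by right.
(* If [X] lies in [Y], then [q] was chosen to make the slack of [X] nonnegative. Otherwise the
   intersection competes with [X'] among the proper subsets of [X]. *)
have [YX|YX] := eqVneq (Y :&: X) X.
  by right; apply: le_trans le; rewrite YX; move/extremumP: qX => [].
left; apply: le_trans le; apply: minX'.
by rewrite finset.properEneq YX finset.subsetIr.
Qed.

Theorem newton_returns_extremum p n r : (#|D| <= n)%N ->
  (forall q, feas q -> stricter p q) -> extremum feas r ->
  newton_returns vt extremum D p n r.
Proof.
move=> Dn feas_le rP; split.
  by apply: (@minimizer_exists (vt p) (fun Y => Y \subset D) D).
move=> X [XD minX]; apply: loop_returns_extremum => //.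
  exact: leq_trans (subset_leq_card XD) Dn.
by move=> Y YD; left; apply: minX.
Qed.

End Newton.

(** * Slack of the extended network *)

Section ExchangeArithmetic.
Variable R : realType.
Implicit Types (x y z w : \bar R) (p q r t : R).

Lemma lee_of_exchange p q r x y z : (p%:E <= x)%E -> (q%:E <= y)%E ->
  (x + y <= z + r%:E)%E -> ((p + q - r)%:E <= z)%E.
Proof.
move=> px qy xyz; rewrite EFinB leeBlDr //; apply: le_trans xyz.
by rewrite EFinD leeD.
Qed.

(** With cut values [x], [y], [z], [w] and balances [p], [r], [q], [t] of two sets, their union and
    their intersection, this subtracts the minimality of the first set from the exchange inequality.
    Negative slack makes [x] finite. *)
Lemma nest_arith x y z w p q r t :
  (0 <= x)%E -> (0 <= y)%E -> (0 <= z)%E -> (0 <= w)%E -> t + q = p + r ->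
  (w + z <= y + x)%E -> (x - p%:E < 0)%E -> (x - p%:E <= z - q%:E)%E ->
  (w - t%:E <= y - r%:E)%E.
Proof.
case: x => [x| |] // _; case: y => [y| |] // _; rewrite ?addye ?leey //.
case: z => [z| |] // _; case: w => [w| |] // _.
by rewrite -!EFinB -!EFinD !lee_fin lte_fin; lra.
Qed.

End ExchangeArithmetic.

Section Setting.
Variables (R : realType) (N : network) (b : vertex N -> int) (T : nat).
Variables (Q Rs : {set vertex N}) (ss s : vertex N) (a0 : darc N).
Hypothesis hb : \sum_(v : vertex N) b v = 0.
Hypothesis hfeas : feasible (balance_in R b) T.
Hypothesis hQR : Q \proper Rs.
Hypothesis hQ : tight R b T Q.
Hypothesis hR : tight R b T Rs.
Hypothesis hss : ss \in Rs :\: Q.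
Hypothesis hsrc : ss \in sources b.
Hypothesis htail : arc_tail a0 = ss.
Hypothesis hhead : arc_head a0 = s.
Hypothesis hcap : capacity a0 = None.
Hypothesis htransit : transit a0 = 0%N.
Hypothesis honly : forall a : darc N, arc_tail a = ss \/ arc_head a = ss -> a = a0.
Implicit Types (c d : nat) (X Y A B : {set vertex N}).

Local Notation o X := (outf R b T X).
Local Notation g c d X := (outf_ext R b T s c d (hat X)).
Local Notation Delta := (Delta R b T s Q).

Definition bal X : R := \sum_(v in X) (b v)%:~R.

Lemma sources_balance_in : sources (balance_in R b) = sources b.
Proof. by apply/setP => v; rewrite !inE /balance_in ltr0z. Qed.

Lemma sinks_balance_in : sinks (balance_in R b) = sinks b.
Proof. by apply/setP => v; rewrite !inE /balance_in ltrz0. Qed.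

Lemma bal_le_cut X (C : {set vertex (texp N T)}) :
  sep b X C -> ((bal X)%:E <= cut_cap R C)%E.
Proof.
move=> sC; apply: (feasible_le_cut hfeas).
by rewrite sources_balance_in sinks_balance_in.
Qed.

Lemma bal_le_outf X : ((bal X)%:E <= o X)%E.
Proof.
have ext0 (C : {set vertex (texp N T)}) : sep b X C -> ext_cut R s 0 0 C = cut_cap R C.
  by move=> _; apply: ext_cut_idle; left.
have [_ [C sC ->]] := min_cut_outf ext0.
by rewrite ext0 // bal_le_cut.
Qed.

Lemma balU A B : bal (A :&: B) + bal (A :|: B) = bal A + bal B.
Proof.
rewrite /bal !(big_mkcond (fun v => v \in _)) -!big_split /=.
apply: eq_bigr => v _; rewrite !inE.
by case: (v \in A); case: (v \in B); rewrite /= ?addr0 ?add0r.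
Qed.

Lemma ss_notin_Q : ss \notin Q.
Proof. by move: hss; rewrite inE => /andP[]. Qed.

Lemma ss_in_Rs : ss \in Rs.
Proof. by move: hss; rewrite inE => /andP[]. Qed.

(** If they were equal, the only arc at [ss] would be a loop, and [ss] could not send its positive
    supply. *)
Lemma s_neq_ss : s != ss.
Proof.
apply/eqP => s_ss.
pose C : {set vertex (texp N T)} := [set u | u.1 == ss].
have sC : sep b [set ss] C.
  apply/separatesP; split=> v k; rewrite !inE => /andP[] //.
have := bal_le_cut sC; rewrite /cut_cap big_pred0 => [|[a k]].
  rewrite /bal big_set1 lee_fin lerz0 leNgt.
  by move: hsrc; rewrite inE => ->.
apply/negP => /andP[]; rewrite !inE /= => /eqP ta /negP; apply; apply/eqP.
by rewrite (honly (or_introl ta)) hhead.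
Qed.

(* A cut of finite capacity that contains [ss] contains every copy of [s], so that
   the new arc is not cut. *)
Lemma ext_cut_ss c d X (C : {set vertex (texp N T)}) : ss \in X -> sep b X C ->
  ext_cut R s c d C = cut_cap R C.
Proof.
move=> ssX /separatesP[CP _]; rewrite /ext_cut.
have [/existsP[j jC]|/existsPn allC] := boolP [exists j : 'I_T, (s, j) \notin C].
  pose e : darc (texp N T) := (a0, j).
  have jE : insubd j (j + transit a0)%N = j.
    by apply: val_inj; rewrite val_insubd htransit addn0 ltn_ord.
  have eC : crosses C e.
    by rewrite /crosses /= jE hhead jC htail CP // inE ssX hsrc.
  have eN : capacity e = None by rewrite /= htransit addn0 ltn_ord.
  by rewrite /cut_cap (sum_ecap_infinite R eC eN) addye_ge0 // lee_fin.
rewrite /extra big_pred0 ?adde0 // => j.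
by have := allC j; rewrite negbK => ->; rewrite andbF.
Qed.

Lemma outf_ext_ss c d X : ss \in X -> g c d X = o X.
Proof.
move=> ssX; apply: min_cut_unique (min_cut_hat R b T s c d X) _.
by apply: min_cut_outf => C; apply: ext_cut_ss.
Qed.

Lemma outf_ext_idle c d X : c = 0%N \/ (T <= d)%N -> g c d X = o X.
Proof.
move=> idle; apply: min_cut_unique (min_cut_hat R b T s c d X) _.
by apply: min_cut_outf => C _; apply: ext_cut_idle.
Qed.

Lemma outf_ext_exchange c d c' d' A B : (c <= c')%N -> (d' <= d)%N ->
  (g c d (A :&: B) + g c' d' (A :|: B) <= g c d B + g c' d' A)%E.
Proof.
move=> cc dd; exact: min_cut_exchange cc dd (min_cut_hat _ _ _ _ _ _ _)
  (min_cut_hat _ _ _ _ _ _ _) (min_cut_hat _ _ _ _ _ _ _)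
  (min_cut_hat _ _ _ _ _ _ _).
Qed.

Lemma outf_exchange c d A B : (o (A :&: B) + g c d (A :|: B) <= o B + g c d A)%E.
Proof. by have := @outf_ext_exchange 0 d c d A B; rewrite !(@outf_ext_idle 0); auto. Qed.

Lemma outf_ext_nat c d X : g c d X = +oo%E \/ exists n : nat, g c d X = n%:R%:E.
Proof. exact: min_cut_nat (min_cut_hat R b T s c d X). Qed.

Lemma outf_ext_ge0 c d X : (0 <= g c d X)%E.
Proof. by case: (outf_ext_nat c d X) => [|[n]] ->; rewrite ?lee_fin. Qed.

(** Tightness makes [o Q] finite, and a minimum cut for it bounds the value in the extended network,
    so both terms are integral cut capacities. Integrality is needed to apply the cut criterion to
    the new balances. *)
Lemma Delta_nat c d : exists m : nat, Delta c d = m%:R /\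
  g c d Q = (bal Q + m%:R)%:E.
Proof.
have ext0 (C : {set vertex (texp N T)}) : sep b Q C -> ext_cut R s 0 0 C = cut_cap R C.
  by move=> _; apply: ext_cut_idle; left.
have [minQ [C sC oQ]] := min_cut_outf ext0.
have [ming [D sD gD]] := min_cut_hat R b T s c d Q.
have oQE : o Q = (bal Q)%:E by exact: hQ.
have capC : cut_cap R C = (bal Q)%:E by rewrite -oQE oQ ext0.
have le_og : ((bal Q)%:E <= g c d Q)%E.
  rewrite -oQE gD; apply: le_trans (minQ D sD) _.
  by rewrite ext0 // leeDl // lee_fin.
have le_g := ming C sC; rewrite /ext_cut capC -EFinD in le_g.
have [k kE] : exists k : nat, bal Q = k%:R.
  have := min_cut_nat (min_cut_outf ext0); rewrite oQE.
  by case=> // -[k [kE]]; exists k.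
case: (outf_ext_nat c d Q) le_g le_og => [->|[n nE]]; first by rewrite leye_eq.
rewrite nE kE !lee_fin ler_nat => _ kn; exists (n - k)%N.
rewrite /Delta outf_old nE oQE kE natrB // -EFinB /=; split=> //.
by congr (_%:E); lra.
Qed.

Lemma Delta_ge0 c d : 0 <= Delta c d.
Proof. by have [m [-> _]] := Delta_nat c d; rewrite ler0n. Qed.

Lemma outf_ext_Q c d : g c d Q = (bal Q + Delta c d)%:E.
Proof. by have [m [-> ->]] := Delta_nat c d. Qed.

Definition old_part (Y : {set option (vertex N)}) : {set vertex N} :=
  [set v | Some v \in Y].

Lemma sum_balance_ext c d (Y : {set option (vertex N)}) :
  \sum_(w in Y) balance_ext R b T ss s Q c d w =
  Delta c d *+ (None \in Y) + bal (old_part Y) - Delta c d *+ (Some ss \in Y).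
Proof.
rewrite big_mkcond big_option /= -addrA; congr (_ + _).
  by case: (_ \in Y).
rewrite /bal [X in _ = X - _]big_mkcond /=.
have -> : Delta c d *+ (Some ss \in Y) =
    \sum_v (if v == ss then Delta c d *+ (Some ss \in Y) else 0).
  by rewrite -big_mkcond big_pred1_eq.
rewrite -sumrB; apply: eq_bigr => v _; rewrite inE.
case: (eqVneq v ss) => [->|ne]; last by rewrite subr0.
by case: (_ \in Y); rewrite ?subr0.
Qed.

(** The balance of [hat X]: when [ss] belongs to [X], the amount moved to the new node cancels. *)
Definition demand c d X : R := bal X + Delta c d *+ (ss \notin X).

Lemma slack_tildeE c d (X : {set option (vertex N)}) :
  slack_tilde R b T ss s Q c d X =
  (g c d (Q :|: old_part X) - (demand c d (Q :|: old_part X))%:E)%E.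
Proof.
have XE : hat Q :|: X = hat (Q :|: old_part X).
  apply/setP => -[v|]; last by rewrite finset.in_setU !in_hatN.
  by rewrite finset.in_setU !in_hat !inE.
have preE : old_part (hat (Q :|: old_part X)) = Q :|: old_part X.
  by apply/setP => v; rewrite inE in_hat.
rewrite /slack_tilde /slack_ext XE sum_balance_ext in_hatN in_hat preE /demand.
congr (_ - _%:E)%E; rewrite mulr1n.
by case: (ss \in _); rewrite /= ?mulr1n ?mulr0n ?subr0 ?addr0; ring.
Qed.

Lemma slack_tilde_ge0 c d (X : {set option (vertex N)}) :
  (0 <= slack_tilde R b T ss s Q c d X)%E =
  ((demand c d (Q :|: old_part X))%:E <= g c d (Q :|: old_part X))%E.
Proof. by rewrite slack_tildeE sube_ge0. Qed.

Lemma demand_ss c d X : ss \in X -> ((demand c d X)%:E <= g c d X)%E.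
Proof.
by move=> ssX; rewrite /demand ssX addr0 outf_ext_ss // bal_le_outf.
Qed.

Lemma slack_tilde_ss c d (X : {set option (vertex N)}) : Some ss \in X ->
  (0 <= slack_tilde R b T ss s Q c d X)%E.
Proof.
by move=> ssX; rewrite slack_tilde_ge0 demand_ss // !inE ssX orbT.
Qed.

(** [Delta] is defined so that [hat Q] has slack 0. *)
Lemma slack_tilde0 c d : (0 <= slack_tilde R b T ss s Q c d finset.set0)%E.
Proof.
have pre0 : Q :|: old_part finset.set0 = Q.
  by apply/setP => v; rewrite !inE orbF.
by rewrite slack_tilde_ge0 pre0 /demand ss_notin_Q mulr1n outf_ext_Q.
Qed.

Lemma Delta_idle c d : c = 0%N \/ (T <= d)%N -> Delta c d = 0.
Proof.
move=> idle; have := outf_ext_Q c d; rewrite outf_ext_idle //.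
have -> : o Q = (bal Q)%:E by exact: hQ.
by move=> -[eq]; lra.
Qed.

(** A new arc of capacity 0, or with transit time at least [T], changes nothing, so the slack is
    that of the given feasible instance. *)
Lemma slack_tilde_idle c d (X : {set option (vertex N)}) :
  c = 0%N \/ (T <= d)%N -> (0 <= slack_tilde R b T ss s Q c d X)%E.
Proof.
move=> idle; rewrite slack_tilde_ge0 outf_ext_idle // /demand Delta_idle //.
by rewrite mul0rn addr0 bal_le_outf.
Qed.

Lemma demandE c d X : ss \notin X -> demand c d X = bal X + Delta c d.
Proof. by rewrite /demand => ->. Qed.

(** The exchange inequality for [Q] and a set [A] containing it: the values at [Q] are [bal Q] plus
    the respective [Delta], which is the change in demand. *)
Lemma slack_tilde_mono c d c' d' (X : {set option (vertex N)}) :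
  (c <= c')%N -> (d' <= d)%N ->
  (0 <= slack_tilde R b T ss s Q c' d' X)%E ->
  (0 <= slack_tilde R b T ss s Q c d X)%E.
Proof.
move=> cc dd slack'; pose A := Q :|: old_part X.
have slack : ((demand c' d' A)%:E <= g c' d' A)%E.
  by move: slack'; rewrite slack_tilde_ge0.
rewrite slack_tilde_ge0 -/A.
have [ssA|ssA] := boolP (ss \in A); first exact: demand_ss.
rewrite (demandE c' d' ssA) in slack; rewrite (demandE c d ssA).
have QA : Q :&: A = Q by apply/finset.setIidPl/finset.subsetUl.
have QA' : Q :|: A = A by apply/finset.setUidPr/finset.subsetUl.
have := outf_ext_exchange Q A cc dd; rewrite QA QA' => ex.
rewrite (outf_ext_Q c d) (outf_ext_Q c' d') in ex.
have := lee_of_exchange (lexx _) slack ex; apply: le_trans.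
rewrite lee_fin; move: (bal Q) (bal A) (Delta c d) (Delta c' d') => q p r t.
lra.
Qed.

(** Demands of sets without [ss] are modular across the two parameter pairs, so the exchange
    inequality holds for slacks. The minimality of [X] against the union then removes the stricter
    terms. *)
Lemma slack_tilde_nest c d c' d' (X Y : {set option (vertex N)}) :
  (c <= c')%N -> (d' <= d)%N -> Some ss \notin X -> Some ss \notin Y ->
  (slack_tilde R b T ss s Q c' d' X < 0)%E ->
  (slack_tilde R b T ss s Q c' d' X <= slack_tilde R b T ss s Q c' d' (X :|: Y))%E ->
  (slack_tilde R b T ss s Q c d (Y :&: X) <= slack_tilde R b T ss s Q c d Y)%E.
Proof.
move=> cc dd ssX ssY.
rewrite (slack_tildeE c' d' X) (slack_tildeE c' d' (X :|: Y)).
rewrite (slack_tildeE c d (Y :&: X)) (slack_tildeE c d Y).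
have -> : Q :|: old_part (X :|: Y) = (Q :|: old_part X) :|: (Q :|: old_part Y).
  by apply/setP => v; rewrite !inE; do !case: (_ \in _).
have -> : Q :|: old_part (Y :&: X) = (Q :|: old_part X) :&: (Q :|: old_part Y).
  by apply/setP => v; rewrite !inE; do !case: (_ \in _).
have ssA : ss \notin Q :|: old_part X by rewrite !inE negb_or ss_notin_Q.
have ssB : ss \notin Q :|: old_part Y by rewrite !inE negb_or ss_notin_Q.
set A := Q :|: old_part X in ssA *; set B := Q :|: old_part Y in ssB *.
have ssI : ss \notin A :&: B by rewrite finset.in_setI (negbTE ssA).
have ssU : ss \notin A :|: B by rewrite finset.in_setU negb_or ssA.
have modular : demand c d (A :&: B) + demand c' d' (A :|: B) =
    demand c' d' A + demand c d B.
  rewrite (demandE _ _ ssI) (demandE _ _ ssU) (demandE _ _ ssA) (demandE _ _ ssB).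
  have := balU A B; move: (bal _) (bal _) (bal _) (bal _) => x y z w.
  by move: (Delta c d) (Delta c' d') => p q; lra.
exact: (nest_arith (outf_ext_ge0 c' d' A) (outf_ext_ge0 c d B)
  (outf_ext_ge0 c' d' (A :|: B)) (outf_ext_ge0 c d (A :&: B)) modular
  (outf_ext_exchange A B cc dd)).
Qed.

Lemma bal_setC1 : bal [set~ ss] = - (b ss)%:~R.
Proof.
have : bal [set~ ss] + (b ss)%:~R = 0.
  rewrite /bal addrC -[RHS](mulr0z 1) -hb rmorph_sum /= [RHS](bigD1 ss) //=.
  by congr (_ + _); apply: eq_bigl => v; rewrite !inE.
by move/eqP; rewrite addr_eq0 => /eqP.
Qed.

(** The only arc at [ss] leaves it, so nothing can be sent to [ss]. This cut forces the supply
    remaining at [ss] to be nonnegative. *)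
Lemma ext_cut_isolated c d :
  ext_cut R s c d [set u : vertex (texp N T) | u.1 != ss] = 0%E.
Proof.
rewrite /ext_cut /cut_cap [X in (X + _)%E]big_pred0 => [|[a k]]; last first.
  apply/negP => /andP[_]; rewrite !inE /= negbK => /eqP ha.
  by move: s_neq_ss; rewrite -hhead -(honly (or_intror ha)) ha eqxx.
rewrite /extra big_pred0 ?adde0 // => j.
by rewrite !inE s_neq_ss andbF.
Qed.

Lemma balance_ext_ss_ge0 c d :
  (demand c d [set~ ss] <= 0) = (0 <= balance_ext R b T ss s Q c d (Some ss)).
Proof.
rewrite /demand bal_setC1 !inE eqxx mulr1n /= eqxx /balance_in.
by apply/idP/idP; lra.
Qed.

Lemma feasible_ext_cut c d X : feasible_ext R b T ss s Q c d -> ss \notin X ->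
  ((demand c d X)%:E <= g c d X)%E.
Proof.
move=> hf ssX.
(* Hence [ss] has not turned into a sink, and a cut separating for [b] also respects the sinks of
   the new balance. *)
have ssb' : 0 <= balance_ext R b T ss s Q c d (Some ss).
  rewrite -balance_ext_ss_ge0 -lee_fin.
  pose D : {set vertex (texp (extend s c d) T)} := [set u | u.1 != Some ss].
  have DN k : (None, k) \in D by rewrite inE.
  have sD : @separates (extend s c d) T
      (sources (balance_ext R b T ss s Q c d) :&: [set~ Some ss])
      (sinks (balance_ext R b T ss s Q c d) :\: [set~ Some ss]) D.
    apply/separatesP; split=> v k.
      by rewrite finset.in_setI => /andP[_]; rewrite !inE.
    by rewrite finset.in_setD => /andP[]; rewrite !inE.
  have := feasible_le_cut hf sD; rewrite cut_cap_full //.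
  have -> : down D = [set u | u.1 != ss] by apply/setP => u; rewrite !inE.
  rewrite ext_cut_isolated sum_balance_ext !inE eqxx /=.
  have -> : old_part [set~ Some ss] = [set~ ss] by apply/setP => v; rewrite !inE.
  by rewrite /demand !inE eqxx /= subr0 addrC.
have [_ [C /separatesP[CP CM] ->]] := min_cut_hat R b T s c d X.
pose D : {set vertex (texp (extend s c d) T)} :=
  [set u | if u.1 is Some v then (v, u.2) \in C else true].
have DC : down D = C by apply/setP => -[v k]; rewrite !inE.
have DN k : (None, k) \in D by rewrite inE.
rewrite -DC -cut_cap_full //.
have -> : demand c d X = \sum_(w in hat X) balance_ext R b T ss s Q c d w.
  rewrite sum_balance_ext in_hatN in_hat (negbTE ssX) subr0 addrC.
  rewrite /demand ssX; congr (_ + _); congr bal.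
  by apply/setP => v; rewrite inE in_hat.
apply: (feasible_le_cut hf); apply/separatesP; split=> -[v|] k //.
- rewrite finset.in_setI in_hat inE [_ \in D]inE => /andP[bv vX].
  apply: CP; rewrite !inE vX andbT; move: bv => /=.
  by rewrite /balance_in ifN ?ltr0z //; apply: contraNneq ssX => <-.
- rewrite finset.in_setD in_hat [_ \in D]inE inE => /andP[vX bv].
  apply: CM; rewrite !inE vX /=; case: (eqVneq v ss) => [vss|ne].
    by move: bv; rewrite vss ltNge ssb'.
  by move: bv => /=; rewrite (negbTE ne) /balance_in ltrz0.
- by rewrite finset.in_setD in_hatN.
Qed.

Lemma feasible_ext_of_cuts c d :
  (forall X, ss \notin X -> ((demand c d X)%:E <= g c d X)%E) ->
  feasible_ext R b T ss s Q c d.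
Proof.
move=> cut.
have ssb' : 0 <= balance_ext R b T ss s Q c d (Some ss).
  rewrite -balance_ext_ss_ge0 -lee_fin; have iso := ext_cut_isolated c d.
  apply: le_trans (cut _ _) _; first by rewrite !inE eqxx.
  rewrite -[leRHS]iso.
  have [+ _] := min_cut_hat R b T s c d [set~ ss]; apply.
  apply/separatesP; split=> v k; rewrite !inE; first by case/andP.
  by rewrite negbK => /andP[].
have [m [mE _]] := Delta_nat c d.
pose beta (w : option (vertex N)) : int :=
  if w is Some v then (if v == ss then b v - m%:Z else b v) else m%:Z.
have betaE : balance_ext R b T ss s Q c d = fun w => (beta w)%:~R.
  apply/funext => -[v|] /=; rewrite mE // /balance_in.
  by case: ifP => // _; rewrite intrD intrN.
have betaR (Y : {set option (vertex N)}) : (\sum_(w in Y) beta w)%:~R =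
    Delta c d *+ (None \in Y) + bal (old_part Y) - Delta c d *+ (Some ss \in Y) :> R.
  by rewrite -sum_balance_ext betaE rmorph_sum.
have bS w : (0 < beta w) = (0 < balance_ext R b T ss s Q c d w).
  by rewrite betaE ltr0z.
have beta0 : \sum_w beta w = 0.
  apply: (@intr_inj R); rewrite -(mulr0z 1).
  have -> : \sum_w beta w = \sum_(w in [set: option (vertex N)]) beta w.
    by apply: eq_bigl => w; rewrite inE.
  rewrite betaR !inE !mulr1n addrAC subrr add0r.
  have -> : bal (old_part [set: option (vertex N)]) = (\sum_v b v)%:~R.
    by rewrite rmorph_sum; apply: eq_bigl => v; rewrite !inE.
  by rewrite hb.
rewrite /feasible_ext betaE.
apply: feasible_of_cuts => // Y D /separatesP[DP DM].
(* If no supply remains at [ss], it is not a source and [D] may miss its copies. Then [ss] is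
   dropped, which does not change the total since its supply equals [Delta]. *)
have [X1 sep1 sum1] : exists2 X1, sep b X1 (down D) &
    bal (old_part Y) - Delta c d *+ (Some ss \in Y) = bal X1 - Delta c d *+ (ss \in X1).
  have sepX X1 : (forall v, v != ss -> (v \in X1) = (Some v \in Y)) ->
      (ss \in X1 -> Some ss \in Y /\ 0 < beta (Some ss)) -> sep b X1 (down D).
    move=> X1Y X1ss; apply/separatesP; split=> v k; rewrite !inE.
      move=> /andP[bv vX]; apply: DP; rewrite finset.in_setI inE.
      case: (eqVneq v ss) => [vss|ne]; last by rewrite /= (negbTE ne) bv -X1Y.
      by rewrite vss in vX *; have [-> ->] := X1ss vX.
    move=> /andP[vX bv]; apply: DM; rewrite finset.in_setD inE.
    have ne : v != ss.
      by apply/eqP => vss; move: hsrc; rewrite inE -vss (lt_gtF bv).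
    by rewrite -X1Y // vX /= (negbTE ne).
  have [pos|npos] := boolP (0 < beta (Some ss)).
    exists (old_part Y); last by rewrite inE.
    by apply: sepX => [v _|]; rewrite inE.
  exists (old_part Y :\ ss).
    apply: sepX => [v ne|]; first by rewrite !inE ne.
    by rewrite !inE eqxx.
  have ssD : (b ss)%:~R = Delta c d.
    move: ssb' npos; rewrite bS le_eqVlt => /orP[/eqP|-> //].
    by rewrite /= eqxx /balance_in => ? _; lra.
  rewrite [ss \in _]inE inE eqxx /= mulr0n subr0.
  have [ssY|ssY] := boolP (Some ss \in Y).
    rewrite mulr1n /bal (bigD1 ss) ?inE //= ssD addrAC subrr add0r.
    by apply: eq_bigl => v; rewrite !inE andbC.
  rewrite mulr0n subr0; congr bal; apply/setP => v; rewrite !inE.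
  by case: (eqVneq v ss) => [->|]; rewrite ?(negbTE ssY).
rewrite betaR -addrA sum1.
have D0 := Delta_ge0 c d.
have le_cut : ((bal X1)%:E <= cut_cap R D)%E.
  exact: le_trans (bal_le_cut sep1) (cut_cap_down R D).
have [ssX|ssX] := boolP (ss \in X1).
  apply: le_trans le_cut; rewrite lee_fin mulr1n.
  by case: (None \in Y); rewrite ?mulr1n ?mulr0n; lra.
rewrite mulr0n subr0.
have [NY|NY] := boolP (None \in Y); last by rewrite mulr0n add0r.
(* If nothing is moved, the new node is not a source and [D] may miss its copies, but the old cut
   condition suffices. *)
have [m0|m0] := posnP m; first by rewrite mE m0 mul0rn add0r.
have DN k : (None, k) \in D.
  by apply: DP; rewrite finset.in_setI NY inE /= ltz_nat m0.
rewrite cut_cap_full //; have [+ _] := min_cut_hat R b T s c d X1.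
move=> /(_ _ sep1); apply: le_trans; apply: le_trans (cut X1 ssX).
by rewrite /demand ssX addrC.
Qed.

(** For arbitrary [X] without [ss], the cut condition is derived by uncrossing with the two tight
    sets, first with [Rs] from above and then with [Q] from below. *)
Lemma feasible_extP c d : feasible_ext R b T ss s Q c d <->
  forall X : {set option (vertex N)}, X \subset hat Rs :\: hat Q ->
    (0 <= slack_tilde R b T ss s Q c d X)%E.
Proof.
split=> [hf X _|slack].
  rewrite slack_tilde_ge0; have [ssA|ssA] := boolP (ss \in Q :|: old_part X).
    exact: demand_ss.
  exact: feasible_ext_cut.
apply: feasible_ext_of_cuts => X ssX.
have ssXQ : ss \notin X :|: Q by rewrite finset.in_setU negb_or ssX ss_notin_Q.
have oQ : o Q = (bal Q)%:E by exact: hQ.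
have mid : ((bal (Rs :&: (X :|: Q)) + Delta c d)%:E <= g c d (Rs :&: (X :|: Q)))%E.
  have QR := fintype.subsetP (proper_sub hQR).
  have := slack (old (Rs :&: (X :|: Q) :\: Q)) _; rewrite slack_tilde_ge0.
  have -> : Q :|: old_part (old (Rs :&: (X :|: Q) :\: Q)) = Rs :&: (X :|: Q).
    apply/setP => v; rewrite !inE in_old !inE.
    by have [/QR ->|] := boolP (v \in Q); rewrite ?orbT ?orbF.
  rewrite demandE; last by rewrite finset.in_setI (negbTE ssXQ) andbF.
  apply; apply/fintype.subsetP => -[v|]; last by rewrite in_oldN.
  rewrite in_old !finset.in_setD !in_hat finset.in_setI.
  by case/and3P=> -> ->.
(* Uncross [X :|: Q] with [Rs]. As [ss] is in [Rs], tightness of [Rs] survives in the extended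
   network. *)
have upper : ((bal (X :|: Q) + Delta c d)%:E <= g c d (X :|: Q))%E.
  have gR : g c d Rs = (bal Rs)%:E by rewrite outf_ext_ss ?ss_in_Rs //; exact: hR.
  have := outf_ext_exchange (X :|: Q) Rs (leqnn c) (leqnn d).
  rewrite gR finset.setIC => ex.
  have ssU : ss \in (X :|: Q) :|: Rs by rewrite finset.in_setU ss_in_Rs orbT.
  have top : ((bal ((X :|: Q) :|: Rs))%:E <= g c d ((X :|: Q) :|: Rs))%E.
    by rewrite outf_ext_ss // bal_le_outf.
  move: ex; rewrite addeC [X in (_ <= X)%E]addeC => ex.
  have := lee_of_exchange top mid ex; apply: le_trans; rewrite lee_fin.
  by have := balU (X :|: Q) Rs; rewrite finset.setIC; lra.
(* Uncross the old value of [Q] with the extended value of [X :&: Q]; the gain at [Q] is exactly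
   [Delta]. *)
have lower : ((bal (X :&: Q) + Delta c d)%:E <= g c d (X :&: Q))%E.
  have := outf_exchange c d (X :&: Q) Q.
  have -> : X :&: Q :&: Q = X :&: Q by rewrite -finset.setIA finset.setIid.
  have -> : X :&: Q :|: Q = Q by apply/finset.setUidPr/finset.subsetIr.
  rewrite outf_ext_Q oQ [X in (_ <= X)%E]addeC => ex.
  have := lee_of_exchange (bal_le_outf _) (lexx _) ex.
  by apply: le_trans; rewrite lee_fin; lra.
(* Finally uncross [X] with [Q] itself, whose extended value is known. *)
have := outf_ext_exchange Q X (leqnn c) (leqnn d).
rewrite outf_ext_Q finset.setIC finset.setUC => ex.
have := lee_of_exchange lower upper ex; apply: le_trans; rewrite lee_fin demandE //.
by have := balU X Q; lra.
Qed.

Lemma card_domain : Rs \subset terminals b ->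
  (#|hat Rs :\: hat Q| <= #|terminals b|)%N.
Proof.
move=> /subset_leq_card; apply: leq_trans.
have <- : #|old Rs| = #|Rs| by apply: card_imset => ? ? [].
apply: subset_leq_card; apply/fintype.subsetP => -[v|].
  by rewrite finset.in_setD in_hat in_hat => /andP[_ vR]; rewrite in_old.
by rewrite finset.in_setD in_hatN.
Qed.

(** [par] turns the loop parameter into capacity and transit time, so one proof serves both
    algorithms; stricter means more capacity and less transit time. *)
Lemma newton_returns_slack (par : nat -> nat * nat) (stricter : rel nat)
    (extremum : (nat -> Prop) -> nat -> Prop) (p r n : nat) :
  antisymmetric stricter -> total stricter ->
  (forall P p, extremum P p <-> P p /\ forall q, P q -> stricter p q) ->
  (forall p q, stricter p q ->
     ((par q).1 <= (par p).1)%N && ((par p).2 <= (par q).2)%N) ->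
  (forall p (X : {set option (vertex N)}),
     (slack_tilde R b T ss s Q (par p).1 (par p).2 X < 0)%E ->
     exists q, extremum
       (fun q => (0 <= slack_tilde R b T ss s Q (par q).1 (par q).2 X)%E) q) ->
  (#|hat Rs :\: hat Q| <= n)%N ->
  (forall q, feasible_ext R b T ss s Q (par q).1 (par q).2 -> stricter p q) ->
  extremum (fun q => feasible_ext R b T ss s Q (par q).1 (par q).2) r ->
  newton_returns (fun q => slack_tilde R b T ss s Q (par q).1 (par q).2) extremum
    (hat Rs :\: hat Q) p n r.
Proof.
move=> anti tot extP mono ext Dn pmin rP.
apply: (newton_returns_extremum anti tot extP _ _ _ _ _ Dn pmin rP).
- by move=> q; apply: feasible_extP.
- by move=> q; apply: slack_tilde0.
- by move=> q q' X /mono/andP[le1 le2]; apply: slack_tilde_mono.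
- exact: ext.
move=> q q' X Y /mono/andP[le1 le2] _ _ neg min.
have [ssY|ssY] := boolP (Some ss \in Y); first by right; apply: slack_tilde_ss.
have ssX : Some ss \notin X.
  by apply/negP => ssX; move: neg; rewrite ltNge slack_tilde_ss.
by left; apply: slack_tilde_nest neg min.
Qed.

End Setting.

(** * Existence of extremal parameters and the two algorithms *)

Lemma is_min_nat_exists (P : nat -> Prop) n : P n -> exists m, is_min_nat P m.
Proof.
move=> Pn; have exP : exists m, `[< P m >] by exists n; apply/asboolP.
case: (ex_minnP exP) => m /asboolP Pm minm; exists m; split=> // k Pk.
by apply: minm; apply/asboolP.
Qed.

Lemma is_max_nat_exists (P : nat -> Prop) n k : P n ->
  (forall m, P m -> (m <= k)%N) -> exists m, is_max_nat P m.
Proof.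
move=> Pn bnd; have exP : exists m, `[< P m >] by exists n; apply/asboolP.
have bndP m : `[< P m >] -> (m <= k)%N by move/asboolP; apply: bnd.
case: (ex_maxnP exP bndP) => m /asboolP Pm maxm; exists m; split=> // j Pj.
by apply: maxm; apply/asboolP.
Qed.

Theorem theorem20 (R : realType) (N : network) (b : vertex N -> int) (T : nat)
    (Q Rs : {set vertex N}) (ss s : vertex N) (a0 : darc N)
    (hu : forall a : darc N, capacity a <> Some 0%N)
    (hT : (0 < T)%N)
    (hb : \sum_(v : vertex N) b v = 0)
    (hfeas : feasible (balance_in R b) T)
    (hQR : Q \proper Rs)
    (hRS : Rs \subset terminals b)
    (hQ : tight R b T Q)
    (hR : tight R b T Rs)
    (hss : ss \in Rs :\: Q)
    (hsrc : ss \in sources b)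
    (htail : arc_tail a0 = ss)
    (hhead : arc_head a0 = s)
    (hcap : capacity a0 = None)
    (htransit : transit a0 = 0%N)
    (honly : forall a : darc N, arc_tail a = ss \/ arc_head a = ss -> a = a0)
    (hgt : (balance_of R b (ss |: Q) < outf R b T (ss |: Q))%E) :
  (forall alpha_max : nat,
     ~ alpha_feasible R b T ss s Q alpha_max ->
     exists2 alpha_star : nat,
       is_max_nat (alpha_feasible R b T ss s Q) alpha_star
     & newton_returns (alpha_slack R b T ss s Q) is_max_nat
         (hat Rs :\: hat Q) alpha_max #|terminals b| alpha_star)
  /\ (exists2 delta_star : nat,
        is_min_nat (delta_feasible R b T ss s Q) delta_star
      & newton_returns (delta_slack R b T ss s Q) is_min_nat
          (hat Rs :\: hat Q) 0 #|terminals b| delta_star).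
Proof.
have feasP c d := @feasible_extP R N b T Q Rs ss s a0 hb hfeas hQR hQ hR hss hsrc
  htail hhead hcap htransit honly c d.
have idle c d X := @slack_tilde_idle R N b T Q ss s hfeas hQ c d X.
have mono c d c' d' X := @slack_tilde_mono R N b T Q ss s a0 hfeas hQ hsrc
  htail hhead hcap htransit c d c' d' X.
have Dn := @card_domain N b Q Rs hRS.
have newton := @newton_returns_slack R N b T Q Rs ss s a0 hb hfeas hQR hQ hR hss hsrc
  htail hhead hcap htransit honly.
split=> [alpha_max infeas|].
  (* Feasibility passes to smaller capacities, so an infeasible value exceeds all feasible ones. *)
  have lt_max alpha : alpha_feasible R b T ss s Q alpha -> (alpha <= alpha_max)%N.
    move=> fa; rewrite leqNgt; apply/negP => lt; apply: infeas.
    by apply/feasP => X XD; apply: mono (ltnW lt) (leqnn 0) _; apply/feasP: X XD.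
  have [|r rP] := @is_max_nat_exists (alpha_feasible R b T ss s Q) 0 alpha_max _ lt_max.
    by apply/feasP => X _; apply: idle; left.
  exists r => //.
  apply: (newton (fun p => (p, 0%N)) (fun p q => q <= p)%N is_max_nat) => //=.
  - by move=> p q /=; rewrite andbC => /anti_leq.
  - by move=> p q ->.
  - move=> p X neg; apply: (@is_max_nat_exists _ 0%N p) => [|q pos].
      by apply: idle; left.
    rewrite leqNgt; apply/negP => lt.
    by move: neg; rewrite ltNge (mono _ _ _ _ _ (ltnW lt) (leqnn 0) pos).
(* The value [T] is feasible because no flow through the new arc can arrive in time. *)
have [|r rP] := @is_min_nat_exists (delta_feasible R b T ss s Q) T.
  by apply/feasP => X _; apply: idle; right.
exists r => //.
apply: (newton (fun p => (1%N, p)) (fun p q => p <= q)%N is_min_nat) => //=.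
- exact: anti_leq.
- by move=> p X _; apply: (@is_min_nat_exists _ T); apply: idle; right.
Qed.
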